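(* The assignment $$H_i\mapsto h_i\quad\text{and}\quad X_i^\pm\mapsto x_i^\pm\qquad\text{for } i\in\mathbb{Z}$$ determines a $\mathbb{Z}$-vertex algebra isomorphism from $(V_{\widehat{\mathfrak{sl}}_\infty}(\ell,0),\sigma)$ to $(F(A,\ell)/I_2,\rho^{(1)})$.
   Context: $N\ge3$ is an integer, $\ell\in\mathbb{C}$. A $\mathbb{Z}$-vertex algebra is a vertex algebra over $\mathbb{C}$ together with a group homomorphism from $\mathbb{Z}$ to its automorphism group; isomorphisms intertwine the actions. **The affine vertex algebra.** $\mathfrak{gl}_\infty$ is the Lie algebra of complex matrices $(d_{i,j})_{i,j\in\mathbb{Z}}$ with finitely many nonzero entries, with matrix units $E_{i,j}$ and form $(E_{i,j},E_{k,l})=\delta_{i,l}\delta_{j,k}$; $\mathfrak{sl}_\infty=[\mathfrak{gl}_\infty,\mathfrak{gl}_\infty]$; $\widehat{\mathfrak{sl}}_\infty=\mathfrak{sl}_\infty\otimes\mathbb{C}[t,t^{-1}]\oplus\mathbb{C}c$, $c$ central, $[a(m),b(n)]=[a,b](m+n)+m\delta_{m+n,0}(a,b)c$. $V_{\widehat{\mathfrak{sl}}_\infty}(\ell,0)$ is the $\widehat{\mathfrak{sl}}_\infty$-module induced from the one-dimensional module of $\mathfrak{sl}_\infty\otimes\mathbb{C}[t]\oplus\mathbb{C}c$ on which $\mathfrak{sl}_\infty\otimes\mathbb{C}[t]$ acts as $0$ and $c$ as $\ell$, with its usual vertex algebra structure, $Y(a,z)=\sum a(n)z^{-n-1}$ for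 $a\equiv a(-1)\mathbf 1$, $a\in\mathfrak{sl}_\infty$. $H_i=E_{i,i}-E_{i+1,i+1}$, $X_i^+=E_{i,i+1}$, $X_i^-=E_{i+1,i}$. $\sigma(n)=\sigma_n$ is the automorphism induced by $E_{i,j}\mapsto E_{i+nN,j+nN}$. $A=(a_{i,j})_{i,j\in\mathbb{Z}}$: $a_{i,i}=2$, $a_{i,i\pm1}=-1$, $a_{i,j}=0$ otherwise. **Vertex algebras from conformal Lie algebras.** A conformal Lie algebra is $(C,Y^+,T)$ with $T$ a linear operator on the vector space $C$ and $Y^+(\cdot,z):C\to\mathrm{Hom}(C,z^{-1}C[z^{-1}])$, $Y^+(u,z)=\sum_{n\ge0}u_nz^{-n-1}$, such that $[T,Y^+(u,z)]=Y^+(Tu,z)=\frac{d}{dz}Y^+(u,z)$, $Y^+(u,z)v=\mathrm{Sing}_z(e^{zT}Y^+(v,-z)u)$, $[Y^+(u,z_1),Y^+(v,z_2)]=\mathrm{Sing}_{z_1}\mathrm{Sing}_{z_2}Y^+(Y^+(u,z_1-z_2)v,z_2)$ (Sing = singular part). Its coefficient Lie algebra is $\widehat C=(C\otimes\mathbb{C}[t,t^{-1}])/\mathrm{Im}(T\otimes1+1\otimes d/dt)$ with $[u(m),v(n)]=\sum_{k\ge0}\binom mk(u_kv)(m+n-k)$, where $u(m)$ is the image of $u\otimes t^m$. With $\widehat C^+=\mathrm{Span}\{u(m):m\ge0\}$, the induced module $V_C=\mathcal{U}(\widehat C)\otimes_{\mathcal{U}(\widehat C^+)}\mathbb{C}$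 ($\mathbb{C}$ trivial) is a vertex algebra with $\mathbf 1=1\otimes1$, $Y(u,z)=\sum u(m)z^{-m-1}$ for $u\equiv u(-1)\otimes1$, $u\in C$. For a set $\mathcal{B}$ and a symmetric function $\mathsf{N}:\mathcal{B}\times\mathcal{B}\to\mathbb{N}$ there is a unique conformal Lie algebra $C(\mathcal{B},\mathsf N)$ generated by $\mathcal{B}$ whose coefficient algebra is presented by generators $b(n)$ ($b\in\mathcal{B},n\in\mathbb{Z}$) and relations $\sum_{i\ge0}(-1)^i\binom{\mathsf N(a,b)}{i}[a(n-i),b(m+i)]=0$. **$F(A,\ell)$ and $I_2$.** Take $\mathcal{B}=\{h_i,x_i^\pm:i\in\mathbb{Z}\}$ and $\mathsf N(h_i,h_j)=2$, $\mathsf N(x_i^\pm,x_j^\pm)=1-\delta_{i,j}$, $\mathsf N(h_i,x_j^\pm)=1$, $\mathsf N(x_i^+,x_j^-)=2\delta_{i,j}$. $F(A,\ell)=V_{C(\mathcal{B},\mathsf N)}/I_1$, where $I_1$ is the ideal generated by $(h_i)_0h_j$, $(h_i)_1h_j-a_{i,j}\ell\mathbf 1$, $(h_i)_0x_j^\pm\mp a_{i,j}x_j^\pm$ ($i,j\in\mathbb{Z}$). $I_2$ is the ideal of $F(A,\ell)$ generated by $(x_i^+)_0x_j^--\delta_{i,j}h_i$ and $(x_i^+)_1x_j^--\delta_{i,j}\ell\mathbf 1$ for $i,j\in\mathbb{Z}$, and $((x_i^\pm)_0)^{1-a_{i,j}}x_j^\pm$ for $i,j\in\mathbb{Z}$ with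 $a_{i,j}\le0$. Images of elements in quotients are denoted by the same symbols. $\rho^{(1)}(n)=\rho_n^{(1)}$ is the automorphism of $F(A,\ell)/I_2$ induced by $h_i\mapsto h_{i+nN}$, $x_i^\pm\mapsto x_{i+nN}^\pm$. *)

(* Defs.v *)
From HB Require Import structures.
From mathcomp Require Import all_boot all_order all_algebra ring.
From mathcomp Require Import generic_quotient ring_quotient.
From mathcomp Require Import boolp classical_sets functions cardinality fsbigop finmap.

Set Implicit Arguments.
Unset Strict Implicit.
Unset Printing Implicit Defensive.

Import Order.TTheory GRing.Theory Num.Theory.
Local Open Scope classical_set_scope.
Local Open Scope ring_scope.
Local Open Scope quotient_scope.

(* Every possibly infinite sum below is written \sum_(i \in [set: I]) F i, the
   sum over the support of F; in each use this support is finite. *)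

Section Subspaces.
Variables (K : numFieldType) (V : lmodType K).

Section Span.
Variable P : set V.

Definition span : {pred V} := fun x =>
  `[< forall S : submodClosed V, (forall v, P v -> v \in S) -> x \in S >].

Fact span_closed : submod_closed span.
Proof.
split; first by apply/asboolP => S _; exact: rpred0.
move=> a u v /asboolP hu /asboolP hv; apply/asboolP => S hS.
by rewrite rpredD ?rpredZ ?hu ?hv.
Qed.
HB.instance Definition _ := GRing.isSubmodClosed.Build K V span span_closed.

Lemma span_incl v : P v -> v \in span.
Proof. by move=> Pv; apply/asboolP => S; exact. Qed.

End Span.

Section Submodule.
Variable S : submodClosed V.

Record submodule := Submodule { subval : V; subvalP : subval \in S }.
HB.instance Definition _ := [isSub for subval].
HB.instance Definition _ := [Choice of submodule by <:].
HB.instance Definition _ := [SubChoice_isSubLmodule of submodule by <:].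

End Submodule.

Section QuotientSpace.
Variable S : submodClosed V.

(* [submodClosed] does not inherit from the [zmodClosed] used by [Quotient]. *)
Definition zmod_of : {pred V} := [in S].
Fact zmod_of_closed : zmod_closed zmod_of.
Proof. exact: GRing.submod_closedB (submodClosedP S). Qed.
HB.instance Definition _ := GRing.isZmodClosed.Build V zmod_of zmod_of_closed.

Definition quotient := Quotient.quot zmod_of.
HB.instance Definition _ := EqQuotient.on quotient.
HB.instance Definition _ := GRing.Zmodule.on quotient.

Definition cls (x : V) : quotient := \pi x.

Lemma cls_repr (q : quotient) : cls (repr q) = q.
Proof. exact: reprK. Qed.

Lemma cls_eq x y : (cls x = cls y) <-> (x - y \in S).
Proof.
have -> : (x - y \in S) = (cls x == cls y) by exact: (Quotient.idealrBE zmod_of x y).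
by split=> /eqP.
Qed.

Lemma clsD x y : cls (x + y) = cls x + cls y.
Proof. exact: Quotient.pi_add. Qed.

Definition quotient_scale (a : K) (q : quotient) : quotient := cls (a *: repr q).

Lemma clsZ a x : cls (a *: x) = quotient_scale a (cls x).
Proof. by apply/cls_eq; rewrite -scalerBr rpredZ //; apply/cls_eq; rewrite cls_repr. Qed.

Fact quotient_scaleA a b q :
  quotient_scale a (quotient_scale b q) = quotient_scale (a * b) q.
Proof. by rewrite -[q]cls_repr -!clsZ scalerA. Qed.

Fact quotient_scale1 : left_id 1 quotient_scale.
Proof. by move=> q; rewrite -[q]cls_repr -clsZ scale1r. Qed.

Fact quotient_scaleDr : right_distributive quotient_scale +%R.
Proof.
by move=> a p q; rewrite -[p]cls_repr -[q]cls_repr -clsD -!clsZ scalerDr clsD.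
Qed.

Fact quotient_scaleDl q : {morph quotient_scale^~ q : a b / a + b}.
Proof. by move=> a b; rewrite -[q]cls_repr -!clsZ scalerDl clsD. Qed.

HB.instance Definition _ := GRing.Zmodule_isLmodule.Build K quotient
  quotient_scaleA quotient_scale1 quotient_scaleDr quotient_scaleDl.

Fact cls_is_linear : linear cls.
Proof. by move=> a x y; rewrite clsD clsZ. Qed.
HB.instance Definition _ := GRing.isLinear.Build K V quotient *:%R cls cls_is_linear.

End QuotientSpace.
End Subspaces.

Section FinitelySupported.
Variables (K : numFieldType) (I : choiceType) (V : lmodType K).

Definition fin_support : {pred I -> V} :=
  fun f => `[< finite_set [set i | f i != 0] >].

Fact fin_support_closed : submod_closed fin_support.
Proof.
split.
  apply/asboolP; rewrite (_ : [set _ | _] = set0) //.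
  by apply/seteqP; split=> i //= /eqP.
move=> a u v /asboolP hu /asboolP hv; apply/asboolP.
apply: (@sub_finite_set _ _ ([set i | u i != 0] `|` [set i | v i != 0])).
  move=> i /= h; have [ui0|] := eqVneq (u i) 0; last by left.
  by right; apply: contra_neq h => vi0; rewrite fctE /= vi0 addr0 scalrfctE ui0 scaler0.
by rewrite finite_setU.
Qed.
HB.instance Definition _ :=
  GRing.isSubmodClosed.Build K (I -> V) fin_support fin_support_closed.

Definition fsf := submodule fin_support.
HB.instance Definition _ := GRing.Lmodule.on fsf.

Definition fsf_val (f : fsf) : I -> V := subval f.
Coercion fsf_val : fsf >-> Funclass.

Fact mono_subproof (i : I) (v : V) : (fun j => if j == i then v else 0) \in fin_support.
Proof.
apply/asboolP; apply: (@sub_finite_set _ _ [set i]) => // j /=.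
by case: (j =P i) => // _ /eqP.
Qed.
Definition mono (i : I) (v : V) : fsf := Submodule (mono_subproof i v).

End FinitelySupported.

Lemma fsbig_mono (K : numFieldType) (I : choiceType) (V W : lmodType K)
    (F : I -> V -> W) (i : I) (v : V) :
  (forall j, F j 0 = 0) -> \sum_(j \in [set: I]) F j (mono i v j) = F i v.
Proof.
move=> F0; rewrite -(fsbig_widen [set i] setT) //.
  by rewrite fsbig_set1 /= /fsf_val /= eqxx.
by move=> j [_ /= ji]; rewrite /fsf_val /=; case: (j =P i).
Qed.

Lemma fsbig_trunc (K : numFieldType) (V : lmodType K) (M : nat) (F : nat -> V) :
  (forall i, (M <= i)%N -> F i = 0) ->
  \sum_(i \in [set: nat]) F i = \sum_(i < M) F i.
Proof.
move=> F0; rewrite -(fsbig_widen `I_M setT) //; first by rewrite -fsbig_ord.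
by move=> i [_ /= /negP]; rewrite -leqNgt; exact: F0.
Qed.

Section Ext.
Variables (K : numFieldType) (I : choiceType) (V : lmodType K).

Lemma fsf_valP a (f g : fsf I V) i : fsf_val (a *: f + g) i = a *: f i + g i.
Proof. by []. Qed.

Lemma fin_supp (f : fsf I V) : finite_set [set i | f i != 0].
Proof. by apply/asboolP; exact: (subvalP f). Qed.

Lemma mono_linear (i : I) : linear (@mono K I V i).
Proof.
move=> a u v; apply: val_inj; apply/funext => j /=.
by rewrite !fctE /=; case: (j =P i); rewrite ?scaler0 ?addr0.
Qed.

Lemma fsbig_supp_sub (W : lmodType K) (D : set I) (F : I -> V -> W) (f : fsf I V) :
  (forall i, F i 0 = 0) -> [set i | f i != 0] `<=` D ->
  \sum_(i \in [set: I]) F i (f i) = \sum_(i \in D) F i (f i).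
Proof.
move=> F0 fD; rewrite -(fsbig_widen D setT) // => i [_ /= nD].
by have [-> //|/fD] := eqVneq (f i) 0.
Qed.

Lemma ext_linear (W : lmodType K) (F : I -> V -> W) : (forall i, linear (F i)) ->
  linear (fun f : fsf I V => \sum_(i \in [set: I]) F i (f i)).
Proof.
move=> linF a f g.
have F0 i : F i 0 = 0.
  have := linF i 1 0 0; rewrite !scale1r addr0 => h.
  by apply: (@addrI _ (F i 0)); rewrite addr0 -h.
have fD : finite_set ([set i | fsf_val f i != 0] `|` [set i | fsf_val g i != 0]).
  by rewrite finite_setU; split; exact: fin_supp.
set D := _ `|` _ in fD.
rewrite !(@fsbig_supp_sub _ D) //.
- rewrite !fsbig_finite // scaler_sumr -big_split; apply: eq_bigr => i _.
  by rewrite /= -linF.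
- by move=> i /= h; right.
- by move=> i /= h; left.
- move=> i /= h; rewrite /D /=.
  have [fi0|] := eqVneq (fsf_val f i) 0; last by left.
  by right; apply: contra_neq h => gi0; rewrite -[LHS]/(a *: fsf_val f i + fsf_val g i) fi0 gi0 scaler0 addr0.
Qed.

Lemma fsf_sum (f : fsf I V) : f = \sum_(i \in [set: I]) mono i (f i).
Proof.
apply: val_inj; apply/funext => j.
have -> : val (\sum_(i \in [set: I]) mono i (f i)) j =
          \sum_(i \in [set: I]) (if j == i then f i else 0).
  rewrite (@fsbig_supp_sub _ [set i | f i != 0] (@mono K I V)) //; last first.
    by move=> i; apply: val_inj; apply/funext => k /=; case: ifP.
  rewrite -(fsbig_widen [set i | f i != 0] setT) //; last first.
    by move=> i [_ /= /negP/negPn/eqP ->]; case: ifP.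
  have fs := fin_supp f.
  rewrite !fsbig_finite //.
  by elim/big_rec2: _ => //= i x y _ <-.
rewrite -(fsbig_widen [set j] setT) //; last first.
  by move=> i [_ /= ij]; case: (j =P i) => // ji; case: ij.
by rewrite fsbig_set1 eqxx.
Qed.

Lemma fsf_ind (P : fsf I V -> Prop) :
  P 0 -> (forall a f g, P f -> P g -> P (a *: f + g)) ->
  (forall i v, P (mono i v)) -> forall f, P f.
Proof.
move=> P0 PD Pm f.
rewrite (fsf_sum f) (@fsbig_supp_sub _ [set i | fsf_val f i != 0] (@mono K I V)) //.
  rewrite fsbig_finite; last exact: fin_supp.
  by elim/big_ind: _ => // x y Px Py; rewrite -[x]scale1r; exact: PD.
by move=> i; apply: val_inj; apply/funext => k /=; case: ifP.
Qed.

End Ext.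

Section LinearSums.
Variables (K : numFieldType).

Lemma linear_at0 (V W : lmodType K) (f : V -> W) : linear f -> f 0 = 0.
Proof.
move=> lf; have := lf 1 0 0; rewrite !scale1r addr0 => h.
by apply: (@addrI _ (f 0)); rewrite addr0 -h.
Qed.

Lemma linear_add (V W : lmodType K) (f : V -> W) : linear f -> forall x y, f (x + y) = f x + f y.
Proof. by move=> lf x y; have := lf 1 x y; rewrite !scale1r. Qed.

Lemma linear_scale (V W : lmodType K) (f : V -> W) :
  linear f -> forall a x, f (a *: x) = a *: f x.
Proof. by move=> lf a x; rewrite -[a *: x]addr0 lf linear_at0 // !addr0. Qed.

Lemma span_ind (V : lmodType K) (G : set V) (P : V -> Prop) :
  P 0 -> (forall a x y, P x -> P y -> P (a *: x + y)) ->
  (forall x, G x -> P x) -> forall x, x \in span G -> P x.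
Proof.
move=> P0 PD PG x /asboolP hx.
pose p : V -> bool := fun x => `[< P x >].
have pc : submod_closed p.
  split; first by apply/asboolP.
  by move=> a u v /asboolP ? /asboolP ?; apply/asboolP; exact: PD.
pose pm := GRing.isSubmodClosed.Build K V p pc.
pose S : submodClosed V := HB.pack p pm.
have := hx S; suff hS : forall v, G v -> v \in S by move/(_ hS)/asboolP.
by move=> v /PG Pv; apply/asboolP.
Qed.

Lemma nat_sum_linear (V W : lmodType K) (F : nat -> V -> W) :
  (forall k, linear (F k)) ->
  (forall v, exists M, forall k, (M <= k)%N -> F k v = 0) ->
  linear (fun v => \sum_(k \in [set: nat]) F k v).
Proof.
move=> lF tF a x y; have [M hM] := tF x; have [M' hM'] := tF y.
have le k : (maxn M M' <= k)%N -> F k x = 0 /\ F k y = 0.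
  by rewrite geq_max => /andP[/hM -> /hM' ->].
have tr z := @fsbig_trunc _ _ (maxn M M') (F^~ z).
rewrite !tr; last 3 first.
- by move=> k /le[].
- by move=> k /le[].
- by move=> k /le[h1 h2]; rewrite lF h1 h2 scaler0 addr0.
by rewrite scaler_sumr -big_split; apply: eq_bigr => k _; rewrite lF.
Qed.

Lemma biext_linear (I J : choiceType) (V1 V2 W : lmodType K)
    (B : I -> J -> V1 -> V2 -> W) :
  (forall i j y, linear (fun x => B i j x y)) -> (forall i j x, linear (B i j x)) ->
  (forall g : fsf J V2, linear (fun f : fsf I V1 =>
     \sum_(i \in [set: I]) \sum_(j \in [set: J]) B i j (f i) (g j))) /\
  (forall f : fsf I V1, linear (fun g : fsf J V2 =>
     \sum_(i \in [set: I]) \sum_(j \in [set: J]) B i j (f i) (g j))).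
Proof.
move=> l1 l2; split=> [g|f].
  apply: (ext_linear (F := fun i x => \sum_(j \in [set: J]) B i j x (g j))) => i a x y.
  have B0 z j : B i j z 0 = 0 by exact: linear_at0.
  rewrite !(@fsbig_supp_sub _ _ _ _ [set j | fsf_val g j != 0] (fun j z => B i j _ z)) //.
  rewrite !fsbig_finite ?scaler_sumr -?big_split; try exact: fin_supp.
  by apply: eq_bigr => j _; rewrite l1.
have B0 z i : \sum_(j \in [set: J]) B i j 0 (fsf_val z j) = 0.
  by rewrite fsbig1 // => j _; rewrite (linear_at0 (l1 i j (fsf_val z j))).
move=> a x y.
rewrite !(@fsbig_supp_sub _ _ _ _ [set i | fsf_val f i != 0]
  (fun i z => \sum_(j \in [set: J]) B i j z (fsf_val _ j))) //.
rewrite !fsbig_finite ?scaler_sumr -?big_split; try exact: fin_supp.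
apply: eq_bigr => i _.
by have := ext_linear (l2 i ^~ (fsf_val f i)) a x y; rewrite /=.
Qed.

End LinearSums.

Record lieAlgebra (K : numFieldType) := LieAlgebra {
  lie_car :> lmodType K;
  lie_br : lie_car -> lie_car -> lie_car;
  lie_linl : forall y, linear (lie_br^~ y);
  lie_linr : forall x, linear (lie_br x);
  lie_alt : forall x, lie_br x x = 0;
  lie_jacobi : forall x y z,
    lie_br x (lie_br y z) = lie_br (lie_br x y) z + lie_br y (lie_br x z)
}.

(* The L-module induced from the one-dimensional module of the subalgebra P on
   which P acts by the character chi, that is U(L) (x)_{U(P)} C_chi
   = U(L) / sum_{p in P} U(L) (p - chi p).  The space spanned by the words in the
   elements of L is the free associative algebra on the set L; [ind_lin] and
   [ind_br] cut it down to U(L).  An element x of L acts on a word by putting x in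
   front of it. *)
Section InducedModule.
Variables (K : numFieldType) (L : lmodType K).
Variables (br : L -> L -> L) (P : set L) (chi : L -> K).

Definition word (w : seq L) : fsf (seq L) (K^o) := mono w (1 : K^o).

Inductive ind_relator : fsf (seq L) (K^o) -> Prop :=
| ind_lin (u v : seq L) (a : K) (x y : L) :
    ind_relator (word (u ++ (a *: x + y) :: v)
                 - (a *: word (u ++ x :: v) + word (u ++ y :: v)))
| ind_br (u v : seq L) (x y : L) :
    ind_relator (word (u ++ x :: y :: v) - word (u ++ y :: x :: v)
                 - word (u ++ br x y :: v))
| ind_char (u : seq L) (p : L) : P p ->
    ind_relator (word (rcons u p) - chi p *: word u).

Definition induced := quotient (span ind_relator).
HB.instance Definition _ := GRing.Lmodule.on induced.

Definition iword (w : seq L) : induced := cls (span ind_relator) (word w).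

End InducedModule.

(* [binz m i] is the binomial coefficient m (m - 1) ... (m - i + 1) / i! for any
   integer m; for m = - (p + 1) it equals (-1)^i binom(p + i, i). *)
Definition binz (m : int) (i : nat) : int :=
  match m with
  | Posz p => ('C(p, i))%:Z
  | Negz p => (-1) ^+ i * ('C(p + i, i))%:Z
  end.

(* [nprod u n v] is u_n v, with Y(u, z) = \sum_n u_n z^(- n - 1). *)
Record vertexAlgebra (K : numFieldType) (V : lmodType K) := VertexAlgebra {
  vac : V;
  nprod : V -> int -> V -> V;
  nprod_linl : forall n v, linear (fun u => nprod u n v);
  nprod_linr : forall u n, linear (nprod u n);
  nprod_trunc : forall u v, exists M : int, forall n, M <= n -> nprod u n v = 0;
  nprod_vac : forall n v, nprod vac n v = if n == -1 then v else 0;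
  nprod_creation : forall v, nprod v (-1) vac = v;
  nprod_regular : forall v n, 0 <= n -> nprod v n vac = 0;
  (* the coefficients of the Jacobi identity *)
  nprod_jacobi : forall u v w m n k,
    \sum_(i \in [set: nat])
       nprod (nprod u (n + i%:Z) v) (m + k - i%:Z) w *~ binz m i =
    \sum_(i \in [set: nat])
       nprod u (m + n - i%:Z) (nprod v (k + i%:Z) w) *~ ((-1) ^+ i * binz n i)
    - \sum_(i \in [set: nat])
       nprod v (n + k - i%:Z) (nprod u (m + i%:Z) w)
         *~ ((-1) ^+ `|n|%N * (-1) ^+ i * binz n i)
}.

Section VertexAlgebraMorphisms.
Variable K : numFieldType.

Definition va_hom (V W : lmodType K) (Y : vertexAlgebra V) (Z : vertexAlgebra W)
    (f : V -> W) : Prop :=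
  [/\ linear f, f (vac Y) = vac Z
    & forall u n v, f (nprod Y u n v) = nprod Z (f u) n (f v)].

Definition va_iso (V W : lmodType K) (Y : vertexAlgebra V) (Z : vertexAlgebra W)
    (f : V -> W) : Prop :=
  va_hom Y Z f /\ bijective f.

Definition Z_action (V : lmodType K) (Y : vertexAlgebra V) (s : int -> V -> V) : Prop :=
  (forall n, va_iso Y Y (s n)) /\ (forall m n v, s (m + n) v = s m (s n v)).

Definition Z_va_iso (V W : lmodType K) (Y : vertexAlgebra V) (s : int -> V -> V)
    (Z : vertexAlgebra W) (r : int -> W -> W) (f : V -> W) : Prop :=
  va_iso Y Z f /\ (forall n v, f (s n v) = r n (f v)).

End VertexAlgebraMorphisms.

Section VertexAlgebraQuotient.
Variables (K : numFieldType) (V : lmodType K) (Y : vertexAlgebra V).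

Definition va_ideal (I : {pred V}) : Prop :=
  forall u n v, v \in I -> nprod Y u n v \in I /\ nprod Y v n u \in I.

Section Generated.
Variable P : set V.

Definition ideal_gen : {pred V} := fun x =>
  `[< forall S : submodClosed V, va_ideal S -> (forall v, P v -> v \in S) -> x \in S >].

Fact ideal_gen_closed : submod_closed ideal_gen.
Proof.
split; first by apply/asboolP => S _ _; exact: rpred0.
move=> a u v /asboolP hu /asboolP hv; apply/asboolP => S iS hS.
by rewrite rpredD ?rpredZ ?hu ?hv.
Qed.
HB.instance Definition _ :=
  GRing.isSubmodClosed.Build K V ideal_gen ideal_gen_closed.

Lemma ideal_gen_ideal : va_ideal ideal_gen.
Proof.
move=> u n v /asboolP hv; split; apply/asboolP => S iS hS.
  by case: (iS u n v (hv S iS hS)).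
by case: (iS u n v (hv S iS hS)).
Qed.

Local Notation Q := (quotient ideal_gen).
Local Notation pr := (cls ideal_gen).

Definition qnprod (p : Q) (n : int) (q : Q) : Q := pr (nprod Y (repr p) n (repr q)).

Lemma pr_nprod u n v : pr (nprod Y u n v) = qnprod (pr u) n (pr v).
Proof.
have linB (f : V -> V) : linear f -> forall x y, f (x - y) = f x - f y.
  by move=> lf x y; rewrite -[in LHS](scaleN1r y) addrC lf scaleN1r addrC.
rewrite /qnprod; apply/cls_eq.
set u' := repr _; set v' := repr _.
have uu' : u - u' \in ideal_gen by apply/cls_eq; rewrite cls_repr.
have vv' : v - v' \in ideal_gen by apply/cls_eq; rewrite cls_repr.
rewrite -(subrKA (nprod Y u' n v)) rpredD //.
  rewrite -(linB (fun x => nprod Y x n v)); last exact: nprod_linl.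
  by case: (ideal_gen_ideal v n uu').
rewrite -(linB (nprod Y u' n)); last exact: nprod_linr.
by case: (ideal_gen_ideal u' n vv').
Qed.

Lemma qnprod_linl n (q : Q) : linear (fun p => qnprod p n q).
Proof.
move=> a p p'; rewrite -[p]cls_repr -[p']cls_repr -[q]cls_repr -linearP -!pr_nprod.
by rewrite (nprod_linl Y n _ a) linearP.
Qed.

Lemma qnprod_linr (p : Q) n : linear (qnprod p n).
Proof.
move=> a q q'; rewrite -[p]cls_repr -[q]cls_repr -[q']cls_repr -linearP -!pr_nprod.
by rewrite (nprod_linr Y _ n a) linearP.
Qed.

Lemma qnprod_trunc (p q : Q) :
  exists M : int, forall n, M <= n -> qnprod p n q = 0.
Proof.
have [M hM] := nprod_trunc Y (repr p) (repr q).
by exists M => n /hM h; rewrite -[p]cls_repr -[q]cls_repr -pr_nprod h linear0.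
Qed.

Lemma qnprod_vac n (q : Q) : qnprod (pr (vac Y)) n q = if n == -1 then q else 0.
Proof.
by rewrite -[q]cls_repr -pr_nprod nprod_vac; case: ifP => // _; rewrite linear0.
Qed.

Lemma qnprod_creation (q : Q) : qnprod q (-1) (pr (vac Y)) = q.
Proof. by rewrite -[q]cls_repr -pr_nprod nprod_creation. Qed.

Lemma qnprod_regular (q : Q) n : 0 <= n -> qnprod q n (pr (vac Y)) = 0.
Proof. by move=> n0; rewrite -[q]cls_repr -pr_nprod nprod_regular ?linear0. Qed.

Lemma nprod_trunc_nat u v (n : int) :
  exists M : nat, forall i, (M <= i)%N -> nprod Y u (n + i%:Z) v = 0.
Proof.
have [M hM] := nprod_trunc Y u v; exists `|M - n|%N => i hi; apply: hM.
by rewrite -lerBlDl (le_trans (ler_norm _)) // -abszE lez_nat.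
Qed.

Lemma pr_fsbig (M : nat) (F : nat -> V) : (forall i, (M <= i)%N -> F i = 0) ->
  pr (\sum_(i \in [set: nat]) F i) = \sum_(i \in [set: nat]) pr (F i).
Proof.
move=> F0; rewrite (fsbig_trunc F0) linear_sum (@fsbig_trunc _ _ M) //.
by move=> i /F0 ->; rewrite linear0.
Qed.

Lemma nprod0 n v : nprod Y 0 n v = 0.
Proof.
have := nprod_linl Y n v 1 0 0; rewrite !scale1r addr0 => h.
by apply: (@addrI _ (nprod Y 0 n v)); rewrite addr0 -h.
Qed.

Lemma nprod0r u n : nprod Y u n 0 = 0.
Proof.
have := nprod_linr Y u n 1 0 0; rewrite !scale1r addr0 => h.
by apply: (@addrI _ (nprod Y u n 0)); rewrite addr0 -h.
Qed.

Lemma qnprod_jacobi (p q r : Q) m n k :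
  \sum_(i \in [set: nat])
     qnprod (qnprod p (n + i%:Z) q) (m + k - i%:Z) r *~ binz m i =
  \sum_(i \in [set: nat])
     qnprod p (m + n - i%:Z) (qnprod q (k + i%:Z) r) *~ ((-1) ^+ i * binz n i)
  - \sum_(i \in [set: nat])
     qnprod q (n + k - i%:Z) (qnprod p (m + i%:Z) r)
       *~ ((-1) ^+ `|n|%N * (-1) ^+ i * binz n i).
Proof.
rewrite -[p]cls_repr -[q]cls_repr -[r]cls_repr.
move: (repr p) (repr q) (repr r) => u v w.
have [M1 h1] := nprod_trunc_nat u v n.
have [M2 h2] := nprod_trunc_nat v w k.
have [M3 h3] := nprod_trunc_nat u w m.
have := congr1 pr (nprod_jacobi Y u v w m n k); rewrite linearB /=.
rewrite (@pr_fsbig M1); last by move=> i /h1 ->; rewrite nprod0 mul0rz.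
rewrite (@pr_fsbig M2); last by move=> i /h2 ->; rewrite nprod0r mul0rz.
rewrite (@pr_fsbig M3); last by move=> i /h3 ->; rewrite nprod0r mul0rz.
under eq_fsbigr do rewrite raddfMz /= !pr_nprod.
under [X in _ = X - _ -> _]eq_fsbigr do rewrite raddfMz /= !pr_nprod.
by under [X in _ = _ - X -> _]eq_fsbigr do rewrite raddfMz /= !pr_nprod.
Qed.

Definition va_quotient : vertexAlgebra Q :=
  VertexAlgebra qnprod_linl qnprod_linr qnprod_trunc qnprod_vac qnprod_creation
    qnprod_regular qnprod_jacobi.

End Generated.
End VertexAlgebraQuotient.

Section ConformalLie.
Variable K : numFieldType.

(* [cprod u n v] is u_n v, with Y^+(u, z) = \sum_(n >= 0) u_n z^(- n - 1); the
   axioms are the coefficients of the defining identities of formal series. *)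
Record conformalLie := ConformalLie {
  cf_car :> lmodType K;
  cf_T : cf_car -> cf_car;
  cprod : cf_car -> nat -> cf_car -> cf_car;
  cf_T_linear : linear cf_T;
  cprod_linl : forall n v, linear (fun u => cprod u n v);
  cprod_linr : forall u n, linear (cprod u n);
  cprod_trunc : forall u v, exists M : nat, forall n, (M <= n)%N -> cprod u n v = 0;
  cprod_derivation : forall u n v,
    cf_T (cprod u n v) - cprod u n (cf_T v) = cprod (cf_T u) n v;
  cprod_Tl : forall u n v, cprod (cf_T u) n v = - (n%:R *: cprod u n.-1 v);
  cprod_skew : forall u n v,
    cprod u n v = \sum_(i \in [set: nat])
      ((-1) ^+ (n + i).+1 / (i`!)%:R) *: iter i cf_T (cprod v (n + i)%N u);
  cprod_jacobi : forall u v w m n,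
    cprod u m (cprod v n w) - cprod v n (cprod u m w) =
    \sum_(i < m.+1) 'C(m, i)%:R *: cprod (cprod u i v) (m + n - i)%N w
}.

Section Coefficient.
Variable C : conformalLie.

(* [fsf int C] is C (x) C[t, t^-1]; [mono m u] is u (x) t^m. *)
Definition coef_relator : set (fsf int C) :=
  [set f | exists (u : C) (m : int), f = mono m (cf_T u) + m%:~R *: mono (m - 1) u].

Definition coef_alg := quotient (span coef_relator).
HB.instance Definition _ := GRing.Lmodule.on coef_alg.

Definition coef (u : C) (m : int) : coef_alg := cls (span coef_relator) (mono m u).

Definition pre_coef_br (f g : fsf int C) : fsf int C :=
  \sum_(m \in [set: int]) \sum_(n \in [set: int]) \sum_(k \in [set: nat])
    (binz m k)%:~R *: mono (m + n - k%:Z) (cprod (f m) k (g n)).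

(* independent of the representatives: see [coef_br_cls] and [coef_brE] *)
Definition coef_br (x y : coef_alg) : coef_alg :=
  cls (span coef_relator) (pre_coef_br (repr x) (repr y)).

Local Notation S := (span coef_relator).

Definition mono_br m n (u v : C) : fsf int C :=
  \sum_(k \in [set: nat]) (binz m k)%:~R *: mono (m + n - k%:Z) (cprod u k v).

Lemma mono_br_l m n v : linear (fun u => mono_br m n u v).
Proof.
apply: (nat_sum_linear (F := fun k u => (binz m k)%:~R *: mono (m + n - k%:Z) (cprod u k v))).
  move=> k a x y; rewrite cprod_linl mono_linear scalerDr !scalerA; congr (_ *: _ + _).
  by rewrite mulrC.
move=> u; have [M hM] := cprod_trunc u v; exists M => k /hM ->.
by rewrite (linear_at0 (@mono_linear K int C _)) scaler0.
Qed.

Lemma mono_br_r m n u : linear (mono_br m n u).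
Proof.
apply: (nat_sum_linear (F := fun k v => (binz m k)%:~R *: mono (m + n - k%:Z) (cprod u k v))).
  move=> k a x y; rewrite cprod_linr mono_linear scalerDr !scalerA; congr (_ *: _ + _).
  by rewrite mulrC.
move=> v; have [M hM] := cprod_trunc u v; exists M => k /hM ->.
by rewrite (linear_at0 (@mono_linear K int C _)) scaler0.
Qed.

Lemma pre_l g : linear (fun f => pre_coef_br f g).
Proof. exact: (biext_linear mono_br_l mono_br_r).1. Qed.

Lemma pre_r f : linear (pre_coef_br f).
Proof. exact: (biext_linear mono_br_l mono_br_r).2. Qed.

Lemma pre_mono m n u v : pre_coef_br (mono m u) (mono n v) = mono_br m n u v.
Proof.
rewrite /pre_coef_br -/(mono_br _ _).
rewrite (fsbig_mono (F := fun m u => \sum_(n' \in [set: int]) mono_br m n' u (mono n v n'))).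
  rewrite (fsbig_mono (F := fun n v => mono_br m n u v)) // => j.
  exact: linear_at0 (mono_br_r _ _ _).
by move=> j; rewrite fsbig1 // => i _; rewrite (linear_at0 (mono_br_l _ _ _)).
Qed.

Lemma binz_diag m k : binz m k.+1 * k.+1%:Z = m * binz (m - 1) k.
Proof.
case: m => [[|p]|p]; first by rewrite /= bin0n !mul0r.
  have -> : p.+1%:Z - 1 = p%:Z by rewrite -addn1 PoszD addrK.
  by rewrite /= -!PoszM mulnC mul_bin_diag.
have -> : Negz p - 1 = Negz p.+1 by rewrite !NegzE -[p.+2]addn1 PoszD opprD.
rewrite /= !NegzE exprS addSn addnS.
have e : ((p + k).+1 - k = p.+1)%N by rewrite -addSn addnK.
have := mul_bin_left (p + k).+1 k; rewrite e => h.
rewrite mulN1r !mulNr -mulrA -PoszM mulnC h PoszM.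
by congr (- _); rewrite mulrCA.
Qed.

Lemma binz_left m k : binz m k.+1 * k.+1%:Z = (m - k%:Z) * binz m k.
Proof.
case: m => p /=.
  rewrite -PoszM mulnC mul_bin_left PoszM.
  by have [kp|pk] := leqP k p; [rewrite subzn | rewrite bin_small ?mulr0].
rewrite exprS addnS mulN1r !mulNr -mulrA -PoszM mulnC -mul_bin_diag.
rewrite NegzE PoszM mulrCA -opprD -PoszD addSn mulNr.
by [].
Qed.

Lemma mono_br_trunc M m n u v : (forall k, (M <= k)%N -> cprod u k v = 0) ->
  mono_br m n u v = \sum_(k < M) (binz m k)%:~R *: mono (m + n - k%:Z) (cprod u k v).
Proof.
move=> hM; apply: fsbig_trunc => k /hM ->.
by rewrite (linear_at0 (@mono_linear K int C _)) scaler0.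
Qed.

Lemma mono_br_Tl m n u v :
  mono_br m n (cf_T u) v + m%:~R *: mono_br (m - 1) n u v = 0.
Proof.
have [M hM] := cprod_trunc u v.
have linm q := @mono_linear K int C q.
rewrite (mono_br_trunc (M := M.+1)); last first.
  by case=> // k /hM; rewrite cprod_Tl /= => ->; rewrite scaler0 oppr0.
rewrite (mono_br_trunc (M := M)) // big_ord_recl /= cprod_Tl scale0r !oppr0.
rewrite (linear_at0 (linm _)) scaler0 add0r scaler_sumr -big_split big1 // => k _ /=.
rewrite cprod_Tl /= -scaleN1r scalerA !(linear_scale (linm _)) !scalerA mulN1r.
rewrite /bump add1n (_ : m + n - k.+1%:Z = m - 1 + n - k%:Z); last first.
  by rewrite -addn1 PoszD; ring.
rewrite -scalerDl mulrN -[k.+1%:R]/((k.+1%:Z)%:~R) -!intrM binz_diag addNr.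
by rewrite scale0r.
Qed.

Local Notation c := (cls S).

Lemma cls_mono_T q (w : C) : c (mono q (cf_T w)) = - (q%:~R *: c (mono (q - 1) w)).
Proof.
rewrite -scaleNr; apply/eqP; rewrite -subr_eq0 -scaleNr opprK; apply/eqP.
rewrite addrC -[X in _ + X]/(c _) -linearP -(linear0 c); apply/cls_eq.
by rewrite subr0; apply: span_incl; exists w, q; rewrite addrC.
Qed.

Lemma cls_mono_br_Tr (m n : int) u v :
  c (mono_br m n u (cf_T v)) + n%:~R *: c (mono_br m (n - 1) u v) = 0.
Proof.
have [M hM] := cprod_trunc u v.
have linm q := @mono_linear K int C q.
pose A (k : nat) := c (mono (m + n - 1 - k%:Z) (cprod u k v)).
have uT k : cprod u k (cf_T v) = k%:R *: cprod u k.-1 v + cf_T (cprod u k v).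
  by rewrite -[LHS](subKr (cf_T (cprod u k v))) cprod_derivation cprod_Tl opprK addrC.
have eT k : c (mono (m + n - k%:Z) (cprod u k (cf_T v))) =
    k%:R *: A k.-1 - (m + n - k%:Z)%:~R *: A k.
  rewrite uT (linear_add (linm _)) (linear_scale (linm _)) linearD linearZ /= cls_mono_T.
  congr (_ + - (_ *: c (mono _ _))); last by ring.
  case: k => [|k]; first by rewrite !scale0r.
  by rewrite /A /=; congr (_ *: c (mono _ _)); rewrite -addn1 PoszD; ring.
rewrite (mono_br_trunc (M := M.+1)); last first.
  case=> // k Mk; rewrite uT /= (hM k) // (hM k.+1) ?leqW //.
  by rewrite (linear_at0 (@cf_T_linear C)) scaler0 addr0.
have AM k : (M <= k)%N -> A k = 0.
  by move=> /hM; rewrite /A => ->; rewrite (linear_at0 (linm _)) linear0.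
rewrite (mono_br_trunc (M := M)) // !linear_sum /=.
under eq_bigr do rewrite linearZ /= eT scalerBr.
rewrite sumrB big_ord_recl [X in _ - X]big_ord_recr /= scale0r scaler0 add0r.
rewrite AM // !scaler0 addr0 -sumrB -big_split big1 // => k _ /=.
rewrite /bump add1n /=.
have -> : m + (n - 1) - k%:Z = m + n - 1 - k%:Z by ring.
have -> : c ((binz m k)%:~R *: mono (m + n - 1 - k%:Z) (cprod u k v)) =
  (binz m k)%:~R *: A k by rewrite linearZ.
rewrite !scalerA -scalerBl -scalerDl.
rewrite -[k.+1%:R]/((k.+1%:Z)%:~R) -!intrM binz_left -intrB -intrD.
by rewrite (_ : _ + _ = 0) ?scale0r //; ring.
Qed.

Lemma pre_coef_br_relator_l f g : f \in S -> pre_coef_br f g \in S.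
Proof.
move=> fS; move: f fS; apply: span_ind.
- by rewrite (linear_at0 (pre_l g)) rpred0.
- by move=> a x y hx hy; rewrite (pre_l g) rpredD ?rpredZ.
move=> _ [u [m ->]]; move: g; apply: fsf_ind.
- by rewrite (linear_at0 (pre_r _)) rpred0.
- by move=> a x y hx hy; rewrite (pre_r _ a) rpredD ?rpredZ.
move=> n v; rewrite addrC (pre_l (mono n v)) !pre_mono addrC mono_br_Tl.
exact: rpred0.
Qed.

Lemma pre_coef_br_relator_r f g : g \in S -> pre_coef_br f g \in S.
Proof.
move=> gS; move: g gS; apply: span_ind.
- by rewrite (linear_at0 (pre_r f)) rpred0.
- by move=> a x y hx hy; rewrite (pre_r f a) rpredD ?rpredZ.
move=> _ [v [n ->]]; move: f; apply: fsf_ind.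
- by rewrite (linear_at0 (pre_l _)) rpred0.
- by move=> a x y hx hy; rewrite (pre_l _ a) rpredD ?rpredZ.
move=> m u; rewrite addrC (pre_r (mono m u)) !pre_mono addrC.
have := cls_mono_br_Tr m n u v.
rewrite -linearZ -linearD -(linear0 c) => /cls_eq; rewrite subr0.
exact.
Qed.

Lemma coef_br_cls f g : coef_br (c f) (c g) = c (pre_coef_br f g).
Proof.
have e (h : fsf int C) : repr (c h) - h \in S by apply/cls_eq; rewrite cls_repr.
apply/cls_eq; set f' := repr _; set g' := repr _.
rewrite -(subrKA (pre_coef_br f g')) rpredD //.
  rewrite addrC -scaleN1r -(pre_l g') scaleN1r addrC.
  by apply: pre_coef_br_relator_l; exact: e.
rewrite addrC -scaleN1r -(pre_r f) scaleN1r addrC.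
by apply: pre_coef_br_relator_r; exact: e.
Qed.

Lemma coef_brE (u v : C) m n : coef_br (coef u m) (coef v n) =
  \sum_(k \in [set: nat]) (binz m k)%:~R *: coef (cprod u k v) (m + n - k%:Z).
Proof.
rewrite coef_br_cls pre_mono.
have [M hM] := cprod_trunc u v.
rewrite (mono_br_trunc _ _ hM) linear_sum (@fsbig_trunc _ _ M).
  by apply: eq_bigr => k _; rewrite linearZ.
move=> k /hM ->; rewrite /coef (linear_at0 (@mono_linear K int C _)).
by rewrite linear0 scaler0.
Qed.

Definition coef_nonneg : set coef_alg :=
  [set x | x \in span [set y | exists (u : C) (m : int), 0 <= m /\ y = coef u m]].

Definition V_C := induced coef_br coef_nonneg (fun=> 0).
HB.instance Definition _ := GRing.Lmodule.on V_C.

Definition V_C_word (w : seq coef_alg) : V_C := iword coef_br coef_nonneg (fun=> 0) w.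
Definition V_C_gen (u : C) : V_C := V_C_word [:: coef u (-1)].

(* By the two conditions below Y is the usual vertex algebra structure, which they
   determine.  The last one is Y(u, z) = \sum u(n) z^(- n - 1), the operator u(n) being
   evaluated on the spanning vectors of V_C. *)
Definition is_V_C (Y : vertexAlgebra V_C) : Prop :=
  vac Y = V_C_word [::] /\
  forall u n w, nprod Y (V_C_gen u) n (V_C_word w) = V_C_word (coef u n :: w).

End Coefficient.

Definition locality (B : Type) (N : B -> B -> nat) (G : zmodType) (br : G -> G -> G)
    (b : B -> int -> G) : Prop :=
  forall x y n m, \sum_(i < (N x y).+1)
    br (b x (n - i%:Z)) (b y (m + i%:Z)) *~ ((-1) ^+ i * ('C(N x y, i))%:Z) = 0.

Definition is_lie_hom (C : conformalLie) (G : lieAlgebra K) (phi : coef_alg C -> G) : Prop :=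
  linear phi /\ forall x y, phi (coef_br x y) = lie_br (phi x) (phi y).

(* C, with iota : B -> C, is the conformal Lie algebra C(B, N): it is generated by
   B, and its coefficient algebra is the Lie algebra with generators b(n) and the
   relations [locality], i.e. it satisfies them and is universal for them. *)
Definition is_conformal_of (B : Type) (N : B -> B -> nat) (C : conformalLie)
    (iota : B -> C) : Prop :=
  [/\ (forall S : submodClosed C, (forall b, iota b \in S) ->
         (forall u, u \in S -> cf_T u \in S) ->
         (forall u n v, u \in S -> v \in S -> cprod u n v \in S) ->
         forall u, u \in S),
      locality N (@coef_br C) (fun b n => coef (iota b) n)
    & forall (G : lieAlgebra K) (b : B -> int -> G), locality N (@lie_br K G) b ->
        exists phi : coef_alg C -> G,
          [/\ is_lie_hom phi, forall x n, phi (coef (iota x) n) = b x n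
            & forall psi, is_lie_hom psi ->
                (forall x n, psi (coef (iota x) n) = b x n) -> psi =1 phi]].

End ConformalLie.

Section AffineSl.
Variable K : numFieldType.

Local Notation gl := (fsf (int * int)%type (K^o)).

Definition matE (i j : int) : gl := mono (i, j) (1 : K^o).

Definition gl_mul (a b : gl) : gl :=
  \sum_(p \in [set: int * int]) \sum_(q \in [set: int * int])
    mono (p.1, q.2) ((p.2 == q.1)%:R * (a p * b q) : K^o).
Definition gl_br (a b : gl) : gl := gl_mul a b - gl_mul b a.
Definition gl_form (a b : gl) : K :=
  \sum_(p \in [set: int * int]) \sum_(q \in [set: int * int])
    ((p.1 == q.2) && (p.2 == q.1))%:R * (a p * b q).

Definition gl_commutators : set gl := [set d | exists a b, d = gl_br a b].

Definition sl := submodule (span gl_commutators).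
HB.instance Definition _ := GRing.Lmodule.on sl.

Fact sl_br_subproof (a b : sl) : gl_br (subval a) (subval b) \in span gl_commutators.
Proof. by apply: span_incl; exists (subval a), (subval b). Qed.
Definition sl_br (a b : sl) : sl := Submodule (sl_br_subproof a b).

Definition sl_entry (a : sl) (i j : int) : K := fsf_val (subval a) (i, j).

Lemma gl_mul_matE i j k l : gl_mul (matE i j) (matE k l) = (j == k)%:R *: matE i l.
Proof.
have mono0 p : mono p (0 : K^o) = 0 :> gl.
  by apply: val_inj; apply/funext => q /=; case: ifP.
rewrite /gl_mul /matE.
rewrite (fsbig_mono (F := fun p (x : K^o) => \sum_(q \in [set: int * int])
  mono (p.1, q.2) ((p.2 == q.1)%:R * (x * mono (k, l) (1 : K^o) q) : K^o))); last first.
  by move=> p; rewrite fsbig1 // => q _; rewrite mul0r mulr0 mono0.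
rewrite (fsbig_mono (F := fun q (x : K^o) =>
  mono (i, q.2) ((j == q.1)%:R * (1 * x) : K^o))); last first.
  by move=> q; rewrite !mulr0 mono0.
rewrite /= mul1r; case: (j == k); first by rewrite mul1r scale1r.
by rewrite mul0r mono0 scale0r.
Qed.

Fact X_subproof (i j : int) : i != j -> matE i j \in span gl_commutators.
Proof.
move=> ij; apply: span_incl; exists (matE i i), (matE i j).
by rewrite /gl_br !gl_mul_matE eqxx eq_sym (negPf ij) scale1r scale0r subr0.
Qed.

Fact H_subproof (i : int) : matE i i - matE (i + 1) (i + 1) \in span gl_commutators.
Proof.
apply: span_incl; exists (matE i (i + 1)), (matE (i + 1) i).
by rewrite /gl_br !gl_mul_matE !eqxx !scale1r.
Qed.

Fact succ_neq (i : int) : i != i + 1.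
Proof. by rewrite -subr_eq0 opprD addNKr oppr_eq0 oner_eq0. Qed.

Fact neq_succ (i : int) : i + 1 != i.
Proof. by rewrite eq_sym succ_neq. Qed.

(* The Boolean stands for the sign: slX true i is X_i^+ and slX false i is X_i^-. *)
Definition slH (i : int) : sl := Submodule (H_subproof i).
Definition slX (s : bool) (i : int) : sl :=
  if s then Submodule (X_subproof (succ_neq i)) else Submodule (X_subproof (neq_succ i)).

(* [fsf int sl] is sl (x) C[t, t^-1], and (f, a) stands for f + a c. *)
Definition aff_sl := (fsf int sl * K^o)%type.
HB.instance Definition _ := GRing.Lmodule.on aff_sl.

Definition aff_mono (a : sl) (m : int) : aff_sl := (mono m a, 0).

Definition aff_br (x y : aff_sl) : aff_sl :=
  (\sum_(m \in [set: int]) \sum_(n \in [set: int]) mono (m + n) (sl_br (x.1 m) (y.1 n)),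
   \sum_(m \in [set: int]) \sum_(n \in [set: int])
     m%:~R * (m + n == 0)%:R * gl_form (subval (x.1 m)) (subval (y.1 n))).

Definition aff_nonneg : set aff_sl := [set x : aff_sl | forall n : int, n < 0 -> x.1 n = 0].

Lemma gl_form_matE i j k l :
  gl_form (matE i j) (matE k l) = ((i == l) && (j == k))%:R.
Proof.
rewrite /gl_form /matE.
rewrite (fsbig_mono (W := K^o) (F := fun p (x : K^o) => \sum_(q \in [set: int * int])
  ((p.1 == q.2) && (p.2 == q.1))%:R * (x * mono (k, l) (1 : K^o) q))); last first.
  by move=> p; rewrite fsbig1 // => q _; rewrite mul0r mulr0.
rewrite (fsbig_mono (W := K^o) (F := fun q (x : K^o) =>
  ((i == q.2) && (j == q.1))%:R * (1 * x))); last by move=> q; rewrite !mulr0.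
by rewrite !mulr1.
Qed.

Lemma aff_brE a b m n : aff_br (aff_mono a m) (aff_mono b n) =
  (mono (m + n) (sl_br a b),
   m%:~R * (m + n == 0)%:R * gl_form (subval a) (subval b)).
Proof.
have mul0 (x : gl) : gl_mul 0 x = 0.
  rewrite /gl_mul fsbig1 // => p _; rewrite fsbig1 // => q _.
  by rewrite mul0r mulr0 (linear_at0 (mono_linear _)).
have mul0' (x : gl) : gl_mul x 0 = 0.
  rewrite /gl_mul fsbig1 // => p _; rewrite fsbig1 // => q _.
  by rewrite mulr0 mulr0 (linear_at0 (mono_linear _)).
have br0 x : sl_br 0 x = 0.
  by apply: val_inj; rewrite /= /gl_br mul0 mul0' subr0.
have br0' x : sl_br x 0 = 0.
  by apply: val_inj; rewrite /= /gl_br mul0 mul0' subr0.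
have form0 x : gl_form 0 x = 0.
  rewrite /gl_form fsbig1 // => p _; rewrite fsbig1 // => q _.
  by rewrite mul0r mulr0.
have form0' x : gl_form x 0 = 0.
  rewrite /gl_form fsbig1 // => p _; rewrite fsbig1 // => q _.
  by rewrite mulr0 mulr0.
have m0 (i : int) : mono i (0 : sl) = 0 by exact: (linear_at0 (mono_linear _)).
congr (_, _).
  rewrite (fsbig_mono (F := fun m a => \sum_(n' \in [set: int])
    mono (m + n') (sl_br a (mono n b n')))); last first.
    by move=> i; rewrite fsbig1 // => j _; rewrite br0 m0.
  by rewrite (fsbig_mono (F := fun n b => mono (m + n) (sl_br a b))) // => i;
     rewrite br0' m0.
rewrite (fsbig_mono (W := K^o) (F := fun m (a : sl) => \sum_(n' \in [set: int])
    m%:~R * (m + n' == 0)%:R * gl_form (subval a) (subval (mono n b n')))); last first.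
  by move=> i; rewrite fsbig1 // => j _; rewrite form0 mulr0.
rewrite (fsbig_mono (W := K^o) (F := fun n (b : sl) =>
   m%:~R * (m + n == 0)%:R * gl_form (subval a) (subval b))) // => i.
by rewrite form0' mulr0.
Qed.

Variable l : K.

Definition V_aff := induced aff_br aff_nonneg (fun x => l * x.2).
HB.instance Definition _ := GRing.Lmodule.on V_aff.

Definition V_aff_word (w : seq aff_sl) : V_aff :=
  iword aff_br aff_nonneg (fun x => l * x.2) w.
Definition V_aff_gen (a : sl) : V_aff := V_aff_word [:: aff_mono a (-1)].

Definition is_V_aff (Y : vertexAlgebra V_aff) : Prop :=
  vac Y = V_aff_word [::] /\
  forall a n w, nprod Y (V_aff_gen a) n (V_aff_word w) = V_aff_word (aff_mono a n :: w).

(* sigma_n is induced by E_{i,j} |-> E_{i + nN, j + nN} *)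
Definition is_sigma (N : nat) (sigma : int -> V_aff -> V_aff) : Prop :=
  forall (n : int) (a b : sl),
    (forall i j, sl_entry b (i + n * N%:Z) (j + n * N%:Z) = sl_entry a i j) ->
    sigma n (V_aff_gen a) = V_aff_gen b.

End AffineSl.

Definition cartan (i j : int) : int :=
  if i == j then 2 else if (j == i + 1) || (j == i - 1) then -1 else 0.

(* [xgen true i] is x_i^+ and [xgen false i] is x_i^-. *)
Inductive gen := hgen (i : int) | xgen (s : bool) (i : int).

Definition locN (a b : gen) : nat :=
  match a, b with
  | hgen _, hgen _ => 2
  | hgen _, xgen _ _ | xgen _ _, hgen _ => 1
  | xgen s i, xgen t j => if s == t then (i != j : nat) else (2 * (i == j))%N
  end.

Section AffineFromCartan.
Variables (K : numFieldType) (l : K) (C : conformalLie K) (iota : gen -> C).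
Variable YC : vertexAlgebra (V_C C).

Local Notation h i := (V_C_gen (iota (hgen i))).
Local Notation x s i := (V_C_gen (iota (xgen s i))).

Inductive I1_relator : V_C C -> Prop :=
| I1_hh0 i j : I1_relator (nprod YC (h i) 0 (h j))
| I1_hh1 i j : I1_relator (nprod YC (h i) 1 (h j) - ((cartan i j)%:~R * l) *: vac YC)
| I1_hx i s j : I1_relator
    (nprod YC (h i) 0 (x s j) - ((-1) ^+ (~~ s) * (cartan i j)%:~R) *: x s j).

Definition F_car := quotient (ideal_gen YC I1_relator).
HB.instance Definition _ := GRing.Lmodule.on F_car.
Definition F_va : vertexAlgebra F_car := va_quotient YC I1_relator.

Definition F_h (i : int) : F_car := cls (ideal_gen YC I1_relator) (h i).
Definition F_x (s : bool) (i : int) : F_car := cls (ideal_gen YC I1_relator) (x s i).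

Inductive I2_relator : F_car -> Prop :=
| I2_xx0 i j : I2_relator
    (nprod F_va (F_x true i) 0 (F_x false j) - (i == j)%:R *: F_h i)
| I2_xx1 i j : I2_relator
    (nprod F_va (F_x true i) 1 (F_x false j) - ((i == j)%:R * l) *: vac F_va)
| I2_serre s i j : cartan i j <= 0 -> I2_relator
    (iter `|1 - cartan i j|%N (nprod F_va (F_x s i) 0) (F_x s j)).

Definition FI2_car := quotient (ideal_gen F_va I2_relator).
HB.instance Definition _ := GRing.Lmodule.on FI2_car.
Definition FI2 : vertexAlgebra FI2_car := va_quotient F_va I2_relator.

Definition FI2_h (i : int) : FI2_car := cls (ideal_gen F_va I2_relator) (F_h i).
Definition FI2_x (s : bool) (i : int) : FI2_car := cls (ideal_gen F_va I2_relator) (F_x s i).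

Definition is_rho (N : nat) (rho : int -> FI2_car -> FI2_car) : Prop :=
  forall n i, rho n (FI2_h i) = FI2_h (i + n * N%:Z) /\
    forall s, rho n (FI2_x s i) = FI2_x s (i + n * N%:Z).

End AffineFromCartan.

(* Main.v *)
From HB Require Import structures.
From mathcomp Require Import all_boot all_order all_algebra ring zify.
From mathcomp Require Import boolp classical_sets functions cardinality fsbigop.
From mathcomp Require Import reals complex.
Require Import Defs.

Set Implicit Arguments.
Unset Strict Implicit.
Unset Printing Implicit Defensive.

Import Order.TTheory GRing.Theory Num.Theory.
Local Open Scope ring_scope.
Local Open Scope complex_scope.

(* Both homomorphisms are constructed and shown to be mutually inverse on generators.

   From F(A,l)/I_2 to V_aff: elements of a vertex algebra W whose n-th products vanish
   for n >= N satisfy the locality relations (Jacobi identity with n = N), so by the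
   universal property the coefficient algebra of C(B, N) acts on W, and V_C maps to W.
   With W = V_aff the relators of I_1 and I_2 are killed.

   From V_aff to W = F(A,l)/I_2: define root vectors by E_(i,j) |-> [x_i, [x_(i+1), ...]]
   and compute the products of the simple root vectors with all of them; since sl is
   generated by the simple root vectors, the resulting linear map psi : sl -> W satisfies
   psi(a)_0 psi(b) = psi([a,b]), psi(a)_1 psi(b) = l (a,b) 1 and psi(a)_n psi(b) = 0 for
   n >= 2.  Hence a(n) |-> psi(a)_n makes W a module over the affine algebra, and the
   vacuum of W generates an image of V_aff. *)

(** The obstacle is to recover sl from Chevalley and Serre relations while controlling every n-th
    product with n >= 0, not only the bracket u_0 v. Pairs with at most a double pole, whose leading
    coefficient is a scalar, behave well under bracketing because 0-th products are derivations and
    kill the vacuum; hence the computation runs through [ope]. Two general root vectors are never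
    bracketed directly: only simple ones act on root vectors, and the rest follows from the Jacobi
    identity and the invariance of the form. The delicate point is that x_k commutes with a root
    vector whose string contains k; this is where the Serre relations enter. The lower triangular
    half is copied from the upper one by the Chevalley involution. For the opposite homomorphism,
    one instance of the Jacobi identity translates between pole bounds and locality relations, and
    it is used in both directions. *)

Lemma submodClosedE (K : numFieldType) (V : lmodType K) (P : V -> Prop) :
  P 0 -> (forall a x y, P x -> P y -> P (a *: x + y)) ->
  exists S : submodClosed V, forall v, v \in S <-> P v.
Proof.
move=> P0 PD; pose p : {pred V} := fun x => `[< P x >].
have pc : submod_closed p.
  split; first by apply/asboolP.
  by move=> a u v /asboolP ? /asboolP ?; apply/asboolP; exact: PD.
pose pm := GRing.isSubmodClosed.Build K V p pc.
pose S : submodClosed V := HB.pack p pm.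
by exists S => v; split=> /asboolP.
Qed.

Section LinearFunctions.
Variables (K : numFieldType) (V W : lmodType K) (f : V -> W).
Hypothesis lf : linear f.

Lemma linear_sub x y : f (x - y) = f x - f y.
Proof. by rewrite -scaleN1r addrC lf scaleN1r addrC. Qed.

Lemma linear_opp x : f (- x) = - f x.
Proof. by rewrite -sub0r linear_sub linear_at0 ?sub0r. Qed.

Lemma linear_sumr (I : Type) (r : seq I) (P : pred I) (F : I -> V) :
  f (\sum_(i <- r | P i) F i) = \sum_(i <- r | P i) f (F i).
Proof. exact: (big_morph f (linear_add lf) (linear_at0 lf)). Qed.

Lemma linear_mulz x n : f (x *~ n) = f x *~ n.
Proof. by rewrite -!scaler_int (linear_scale lf). Qed.

End LinearFunctions.

(** * Consequences of the Jacobi identity *)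

Section VertexAlgebraIdentities.
Variables (K : numFieldType) (V : lmodType K) (Y : vertexAlgebra V).
Local Notation np := (nprod Y).

Lemma nprodZl n a u w : np (a *: u) n w = a *: np u n w.
Proof. exact: (linear_scale (nprod_linl Y n w)). Qed.
Lemma nprodZr n a u w : np u n (a *: w) = a *: np u n w.
Proof. exact: (linear_scale (nprod_linr Y u n)). Qed.
Lemma nprodNl n u w : np (- u) n w = - np u n w.
Proof. by rewrite -scaleN1r nprodZl scaleN1r. Qed.
Lemma nprodNr n u w : np u n (- w) = - np u n w.
Proof. by rewrite -scaleN1r nprodZr scaleN1r. Qed.

(** At n = 0 in the Jacobi identity, the binomials binom(0, i) leave only the term i = 0 in each sum
    on the right. *)
Lemma nprod_commutator u v w m k M : (forall i, (M <= i)%N -> np u i%:Z v = 0) ->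
  np u m (np v k w) - np v k (np u m w) =
  \sum_(i < M) np (np u i%:Z v) (m + k - i%:Z) w *~ binz m i.
Proof.
move=> hM; have := nprod_jacobi Y u v w m 0 k.
rewrite (@fsbig_trunc _ _ M); last by move=> i /hM h; rewrite add0r h nprod0 mul0rz.
rewrite (@fsbig_trunc _ _ 1%N); last by case=> // i _; rewrite /= mulr0 mulr0z.
rewrite (@fsbig_trunc _ _ 1%N); last by case=> // i _; rewrite /= mulr0 mulr0z.
rewrite !big_ord1 !subr0 add0r /= !mulr1z => <-.
by apply: eq_bigr => i _; rewrite add0r.
Qed.

Lemma nprod0_derivation u v w k :
  np u 0 (np v k w) = np (np u 0 v) k w + np v k (np u 0 w).
Proof.
have [M hM] := nprod_trunc_nat Y u v 0.
apply/eqP; rewrite -subr_eq; apply/eqP.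
rewrite (@nprod_commutator u v w 0 k M.+1); last first.
  by move=> i Mi; rewrite -(add0r i%:Z) hM // ltnW.
rewrite big_ord_recl big1 => [|i _]; last by rewrite /= bin0n mulr0z.
by rewrite /= mulr1z add0r subr0 addr0.
Qed.

Lemma nprod_vac_r u (n : nat) : np u n (vac Y) = 0.
Proof. exact: nprod_regular. Qed.

(** In general v_n u also involves T^j (u_(n+j) v) / j! for j > 0; these vanish because T kills
    multiples of the vacuum. The Jacobi identity on the vacuum with m = -1, k = 0 gives the formula
    without introducing T. *)
Lemma nprod_skew u v (n : nat) :
  (forall j : nat, (n < j)%N -> exists c, np u j v = c *: vac Y) ->
  np v n u = (-1) ^+ n.+1 *: np u n v.
Proof.
move=> hc; have := nprod_jacobi Y u v (vac Y) (-1) n 0.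
rewrite (@fsbig_trunc _ _ 1%N); last first.
  move=> i i0; rewrite -PoszD; have [|c ->] := hc (n + i)%N; first by lia.
  rewrite nprodZl nprod_vac; case: eqP => [|_]; first by lia.
  by rewrite scaler0 mul0rz.
rewrite fsbig1; last by move=> i _; rewrite nprod_regular // nprod0r mul0rz.
rewrite (@fsbig_trunc _ _ 1%N); last first.
  by move=> i i0; rewrite [np u _ _]nprod_regular ?nprod0r ?mul0rz //; lia.
rewrite !big_ord1 sub0r !addr0 /= expr0 mulr1 !bin0 mulr1z !nprod_creation mulr1 => ->.
rewrite -scaler_int scalerN scalerA rmorphXn /= exprS mulN1r mulNr scaleNr opprK.
by rewrite rmorphN1 -exprMn mulrNN mulr1 expr1n scale1r.
Qed.

(** The Jacobi identity at n = N, with its last sum reversed so that the right side becomes a sum of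
    commutators. The left side only sees the products u_(N+i) v, which links their vanishing to
    locality. *)
Lemma locality_jacobi (N : nat) u v w m k :
  \sum_(i \in [set: nat]) np (np u (N%:Z + i%:Z) v) (m + k - i%:Z) w *~ binz m i =
  \sum_(i < N.+1) (np u (m + N%:Z - i%:Z) (np v (k + i%:Z) w)
     - np v (k + i%:Z) (np u (m + N%:Z - i%:Z) w)) *~ ((-1) ^+ i * ('C(N, i))%:Z).
Proof.
rewrite nprod_jacobi.
rewrite (@fsbig_trunc _ _ N.+1); last first.
  by move=> i Ni; rewrite /= bin_small // mulr0 mulr0z.
rewrite (@fsbig_trunc _ _ N.+1); last first.
  by move=> i Ni; rewrite /= bin_small // mulr0 mulr0z.
rewrite [X in _ - X](reindex_inj rev_ord_inj) /= -sumrB; apply: eq_bigr => i _.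
have iN : (i <= N)%N by rewrite -ltnS.
rewrite subSS mulrzBl; congr (_ - _).
rewrite bin_sub // -signr_odd -[(-1) ^+ (N - i)]signr_odd -signr_addb.
rewrite -[(-1) ^+ i in RHS]signr_odd oddB // addbA addbb addFb.
have -> : N%:Z + k - (N - i)%N%:Z = k + i%:Z by lia.
by have -> : m + (N - i)%N%:Z = m + N%:Z - i%:Z by lia.
Qed.

(* By induction on n, evaluating locality_jacobi on the vacuum with m = n - N, k = -1. *)
Lemma nprod_vanish (N : nat) u v :
  (forall w m k, \sum_(i < N.+1) (np u (m - i%:Z) (np v (k + i%:Z) w)
     - np v (k + i%:Z) (np u (m - i%:Z) w)) *~ ((-1) ^+ i * ('C(N, i))%:Z) = 0) ->
  forall n : nat, (N <= n)%N -> np u n v = 0.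
Proof.
move=> loc n /subnK <-; rewrite addnC; elim/ltn_ind: (n - N)%N => p IH.
have := locality_jacobi N u v (vac Y) p (-1); rewrite loc.
rewrite (@fsbig_trunc _ _ p.+1); last first.
  by move=> i pi; rewrite /= bin_small // mulr0z.
rewrite big_ord_recr big1 /= => [|i _]; last by rewrite -PoszD IH // nprod0 mul0rz.
rewrite add0r binn mulr1z (_ : p%:Z + -1 - p%:Z = -1) ?nprod_creation ?PoszD //; ring.
Qed.

End VertexAlgebraIdentities.

(** * Generators, homomorphisms and quotients *)

Section Generation.
Variables (K : numFieldType) (V : lmodType K) (Y : vertexAlgebra V).

Definition va_generated (G : set V) : Prop := forall P : V -> Prop,
  P (vac Y) -> (forall a x y, P x -> P y -> P (a *: x + y)) ->
  (forall u n v, P u -> P v -> P (nprod Y u n v)) ->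
  (forall g, G g -> P g) -> forall v, P v.

Lemma va_hom_ext (G : set V) (W : lmodType K) (Z : vertexAlgebra W) (f g : V -> W) :
  va_generated G -> va_hom Y Z f -> va_hom Y Z g -> (forall v, G v -> f v = g v) ->
  f =1 g.
Proof.
move=> gen [lf f1 fM] [lg g1 gM] fg; apply: (gen (fun v => f v = g v)) => //.
- by rewrite f1 g1.
- by move=> a x y fx fy; rewrite lf lg fx fy.
- by move=> u n v fu fv; rewrite fM gM fu fv.
Qed.

(* The Jacobi identity with m = 0 expresses (u_n v)_k through the modes of u and v. *)
Lemma va_hom_generated (G : set V) (W : lmodType K) (Z : vertexAlgebra W) (f : V -> W) :
  va_generated G -> linear f -> f (vac Y) = vac Z ->
  (forall g n v, G g -> f (nprod Y g n v) = nprod Z (f g) n (f v)) -> va_hom Y Z f.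
Proof.
move=> gen lf f1 fG; split=> //; apply: gen.
- move=> n v; rewrite f1 !nprod_vac; case: ifP => // _; exact: linear_at0.
- by move=> a x y fx fy n v; rewrite (nprod_linl Y n v) !lf (nprod_linl Z) fx fy.
- move=> u p v fu fv k w.
  have assoc (X : lmodType K) (A : vertexAlgebra X) (x y z : X) (M : nat) :
      (forall i, (M <= i)%N -> nprod A y (k + i%:Z) z = 0) ->
      (forall i, (M <= i)%N -> nprod A x i%:Z z = 0) ->
      nprod A (nprod A x p y) k z =
      \sum_(i < M) nprod A x (p - i%:Z) (nprod A y (k + i%:Z) z) *~ ((-1) ^+ i * binz p i)
      - \sum_(i < M) nprod A y (p + k - i%:Z) (nprod A x i%:Z z)
         *~ ((-1) ^+ `|p|%N * (-1) ^+ i * binz p i).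
    move=> h1 h2; have := nprod_jacobi A x y z 0 p k.
    rewrite (@fsbig_trunc _ _ 1%N); last by case=> // i _; rewrite /= mulr0z.
    rewrite (@fsbig_trunc _ _ M); last by move=> i /h1 ->; rewrite nprod0r mul0rz.
    rewrite (@fsbig_trunc _ _ M); last by move=> i /h2 h; rewrite add0r h nprod0r mul0rz.
    rewrite big_ord1 /= mulr1z !addr0 !add0r => ->.
    by congr (_ - _); apply: eq_bigr => i _; rewrite !add0r.
  have [M1 h1] := nprod_trunc_nat Y v w k.
  have [M2 h2] := nprod_trunc_nat Y u w 0.
  have h2' i : (M2 <= i)%N -> nprod Y u i w = 0 by move=> /h2; rewrite add0r.
  have f0 := linear_at0 lf.
  pose M := maxn M1 M2.
  have le1 i : (M <= i)%N -> (M1 <= i)%N by rewrite geq_max => /andP[].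
  have le2 i : (M <= i)%N -> (M2 <= i)%N by rewrite geq_max => /andP[].
  rewrite (@assoc _ _ _ _ _ M); last 2 first.
  - by move=> i /le1/h1.
  - by move=> i /le2/h2'.
  rewrite (fu p v) (@assoc _ _ _ _ _ M); last 2 first.
  - by move=> i /le1/h1; rewrite -fv => ->.
  - by move=> i /le2/h2'; rewrite -fu => ->.
  rewrite (linear_sub lf) !(linear_sumr lf).
  by congr (_ - _); apply: eq_bigr => i _; rewrite (linear_mulz lf) ?fu ?fv ?fu.
- by move=> g Gg n v; exact: fG.
Qed.

Lemma va_hom_comp (W X : lmodType K) (Z : vertexAlgebra W) (A : vertexAlgebra X)
    (f : V -> W) (g : W -> X) :
  va_hom Y Z f -> va_hom Z A g -> va_hom Y A (g \o f).
Proof.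
move=> [lf f1 fM] [lg g1 gM]; split=> [a u v||u n v] /=.
- by rewrite lf lg.
- by rewrite f1.
- by rewrite fM gM.
Qed.

Lemma va_hom_id : va_hom Y Y id.
Proof. by []. Qed.

Lemma va_hom_cls (R : set V) : va_hom Y (va_quotient Y R) (cls (ideal_gen Y R)).
Proof. by split=> [|//|u n v]; [exact: linearP|rewrite /= pr_nprod]. Qed.

Lemma ideal_gen0 (R : set V) v : R v -> cls (ideal_gen Y R) v = 0.
Proof.
move=> Rv; rewrite -(linear0 (cls (ideal_gen Y R))); apply/cls_eq; rewrite subr0.
by apply/asboolP => S _; exact.
Qed.

(** The kernel of [f] is an ideal containing [R], so [f] takes the same value on all representatives
    of a class. *)
Lemma va_quotient_hom (R : set V) (W : lmodType K) (Z : vertexAlgebra W) (f : V -> W) :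
  va_hom Y Z f -> (forall v, R v -> f v = 0) ->
  exists2 g, va_hom (va_quotient Y R) Z g & forall v, g (cls (ideal_gen Y R) v) = f v.
Proof.
move=> [lf f1 fM] fR.
have f0 := linear_at0 lf.
have [S SE] : exists S : submodClosed V, forall v, v \in S <-> f v = 0.
  by apply: submodClosedE => // a x y fx fy; rewrite lf fx fy scaler0 addr0.
have Sid : va_ideal Y S.
  by move=> u n v /SE fv; split; apply/SE; rewrite fM fv ?nprod0 ?nprod0r.
have gE v : f (repr (cls (ideal_gen Y R) v)) = f v.
  have /asboolP/(_ S Sid) : repr (cls (ideal_gen Y R) v) - v \in ideal_gen Y R.
    by apply/cls_eq; rewrite cls_repr.
  have SR w : R w -> w \in S by move=> /fR/SE.
  move/(_ SR)/SE; rewrite -scaleN1r addrC lf scaleN1r addrC => /eqP.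
  by rewrite subr_eq0 => /eqP.
exists (fun q => f (repr q)) => //; split=> [a p q||p n q].
- by rewrite -[p]cls_repr -[q]cls_repr -linearP !gE lf.
- by rewrite /= gE.
- by rewrite -[p]cls_repr -[q]cls_repr /= -pr_nprod !gE fM.
Qed.

End Generation.

Lemma va_generated_quotient (K : numFieldType) (V : lmodType K) (Y : vertexAlgebra V)
  (G R : set V) : va_generated Y G ->
  va_generated (va_quotient Y R) (cls (ideal_gen Y R) @` G)%classic.
Proof.
move=> gen P P1 PD PM PG v; rewrite -[v]cls_repr; move: (repr v).
apply: gen => //.
- by move=> a x y Px Py; rewrite linearP; exact: PD.
- by move=> u n w Pu Pw; rewrite pr_nprod; exact: PM.
- by move=> g Gg; apply: PG; exists g.
Qed.

(** * Induced modules *)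

Section InducedModules.
Variables (K : numFieldType) (L : lmodType K) (br : L -> L -> L).
Variables (P : set L) (chi : L -> K).
Local Notation M := (induced br P chi).
Local Notation iw := (iword br P chi).

Lemma iword_ind (Q : M -> Prop) :
  (forall a x y, Q x -> Q y -> Q (a *: x + y)) -> (forall w, Q (iw w)) ->
  forall x, Q x.
Proof.
move=> QD Qw x; rewrite -[x]cls_repr; move: (repr x).
have Q0 : Q 0 by have := QD (-1) _ _ (Qw [::]) (Qw [::]); rewrite scaleN1r addNr.
apply: fsf_ind => [|a f g|w c]; first by rewrite linear0.
  by move=> Qf Qg; rewrite linearP; exact: QD.
have -> : mono w (c : K^o) = c *: word w + 0.
  by rewrite addr0 -(linear_scale (mono_linear w)) /GRing.scale /= mulr1.
by rewrite linearP linear0; apply: QD (Qw w) Q0.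
Qed.

Lemma iword_lin u v a x y :
  iw (u ++ (a *: x + y) :: v) = a *: iw (u ++ x :: v) + iw (u ++ y :: v).
Proof. by rewrite /iword -linearP; apply/cls_eq; apply: span_incl; exact: ind_lin. Qed.

Lemma iword_linear v : linear (fun x => iw (x :: v)).
Proof. by move=> a x y; exact: (iword_lin [::]). Qed.

Lemma iword_br u x y v :
  iw (u ++ br x y :: v) = iw (u ++ x :: y :: v) - iw (u ++ y :: x :: v).
Proof.
apply/eqP; rewrite eq_sym -subr_eq0 /iword -!linearB /= -(linear0 (cls _)).
apply/eqP/cls_eq; rewrite subr0; apply: span_incl; exact: ind_br.
Qed.

Lemma iword_char u p : P p -> iw (rcons u p) = chi p *: iw u.
Proof.
by move=> Pp; rewrite /iword -linearZ; apply/cls_eq; apply: span_incl; exact: ind_char.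
Qed.

Variables (W : lmodType K) (r : L -> W -> W) (w0 : W).
Hypothesis r_linl : forall w, linear (r^~ w).
Hypothesis r_linr : forall x, linear (r x).
Hypothesis r_br : forall x y w, r (br x y) w = r x (r y w) - r y (r x w).
Hypothesis r_char : forall p, P p -> r p w0 = chi p *: w0.

(** Words are evaluated on [w0]. Relators of the first two kinds sit inside a word and require
    identities of operators on [W]; those of [ind_char] sit at its end, next to [w0]. *)
Lemma induced_hom : exists f : M -> W,
  [/\ linear f, f (iw [::]) = w0 & forall x w, f (iw (x :: w)) = r x (f (iw w))].
Proof.
pose ev (s : seq L) := foldr r w0 s.
pose F (f : fsf (seq L) K^o) : W := \sum_(s \in [set: seq L]%classic) (f s : K) *: ev s.
have lF : linear F.
  apply: (ext_linear (F := fun s (c : K^o) => (c : K) *: ev s)) => s a x y.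
  by rewrite scalerDl scalerA.
have Fw s : F (word s) = ev s.
  rewrite /F (fsbig_mono (F := fun s (c : K^o) => (c : K) *: ev s)) ?scale1r //.
  by move=> j; rewrite scale0r.
have ev_lin u : linear (fun w => foldr r w u).
  by elim: u => //= x u IH a v w; rewrite IH r_linr.
have F_rel f : f \in span (ind_relator br P chi) -> F f = 0.
  move: f; apply: span_ind; first exact: linear_at0.
    by move=> a x y fx fy; rewrite lF fx fy scaler0 addr0.
  move=> _ [u v a x y|u v x y|u p Pp].
  - rewrite (linear_sub lF) lF !Fw /ev !foldr_cat /= r_linl ev_lin.
    by rewrite subrr.
  - rewrite !(linear_sub lF) !Fw /ev !foldr_cat /= r_br (linear_sub (ev_lin u)).
    by rewrite subrr.
  - rewrite (linear_sub lF) (linear_scale lF) !Fw /ev foldr_rcons r_char //.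
    by rewrite (linear_scale (ev_lin u)) subrr.
have Fcls f : F (repr (cls (span (ind_relator br P chi)) f)) = F f.
  apply/eqP; rewrite -subr_eq0 -(linear_sub lF); apply/eqP/F_rel/cls_eq.
  exact: cls_repr.
exists (fun q => F (repr q)); split=> [a p q||x w].
- by rewrite -[p]cls_repr -[q]cls_repr -linearP !Fcls lF.
- by rewrite /iword Fcls Fw.
- by rewrite /iword !Fcls !Fw.
Qed.

End InducedModules.

(** * Linear operators as a Lie algebra, the target for the universal property of C(B, N) *)

Section Endomorphisms.
Variables (K : numFieldType) (V : lmodType K).

Definition lin_fun : {pred V -> V} := fun f => `[< linear f >].

Fact lin_fun_closed : submod_closed lin_fun.
Proof.
split; first by apply/asboolP => a x y; rewrite [RHS]/= scaler0 addr0.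
move=> a f g /asboolP lf /asboolP lg; apply/asboolP => b x y.
rewrite !fctE /= lf lg !scalerDr !scalerA [b * a]mulrC -!addrA; congr (_ + _).
by rewrite addrCA.
Qed.
HB.instance Definition _ := GRing.isSubmodClosed.Build K (V -> V) lin_fun lin_fun_closed.

Definition endo := submodule lin_fun.
HB.instance Definition _ := GRing.Lmodule.on endo.

Lemma endo_linear (f : endo) : linear (subval f).
Proof. by apply/asboolP; exact: (subvalP f). Qed.

Fact endo_br_subproof (f g : endo) :
  (fun x => subval f (subval g x) - subval g (subval f x)) \in lin_fun.
Proof.
apply/asboolP => a x y; rewrite !endo_linear scalerBr opprD !addrA; congr (_ - _).
by rewrite addrAC.
Qed.
Definition endo_br (f g : endo) : endo := Submodule (endo_br_subproof f g).

Lemma endo_ext (f g : endo) : (forall x, subval f x = subval g x) -> f = g.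
Proof. by move=> fg; apply: val_inj; apply/funext. Qed.

Fact endo_linl g : linear (endo_br^~ g).
Proof.
move=> a f f'; apply: endo_ext => x; rewrite /= !fctE /= endo_linear.
by rewrite scalerBr opprD !addrA; congr (_ - _); rewrite addrAC.
Qed.

Fact endo_alt f : endo_br f f = 0.
Proof. by apply: endo_ext => x; rewrite /= subrr. Qed.

Fact endo_linr f : linear (endo_br f).
Proof.
move=> a g g'; apply: endo_ext => x; rewrite /= !fctE /= endo_linear.
by rewrite scalerBr opprD !addrA; congr (_ - _); rewrite addrAC.
Qed.

Fact endo_jacobi f g h :
  endo_br f (endo_br g h) = endo_br (endo_br f g) h + endo_br g (endo_br f h).
Proof.
apply: endo_ext => x; rewrite /= !fctE /= !(linear_sub (endo_linear _)).
set A := subval f _; set B := subval f _; set C := subval g _; set D := subval h (subval f _).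
set E := subval g (subval h _); set G := subval h (subval g _).
rewrite !opprB !addrA [RHS](ACl ((1*8*3*6)*(2*5)*(4*7))) /=.
by rewrite !addNr !addr0.
Qed.

Definition endo_lie := LieAlgebra endo_linl endo_linr endo_alt endo_jacobi.

End Endomorphisms.

(** * The universal property of V_C *)

Section ConformalVertexAlgebra.
Variables (K : numFieldType) (C : conformalLie K) (Y : vertexAlgebra (V_C C)).
Hypothesis hY : is_V_C Y.
Local Notation vw := (V_C_word (C := C)).
Local Notation gn := (V_C_gen (C := C)).

Lemma coef_linear m : linear (fun u : C => coef u m).
Proof. by move=> a u v; rewrite /coef (mono_linear m a u v) linearP. Qed.

Lemma coefT (u : C) m : coef (cf_T u) m = - (m%:~R *: coef u (m - 1)).
Proof. exact: cls_mono_T. Qed.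

Lemma coef_nonneg_coef (u : C) (m : int) : 0 <= m -> coef_nonneg (coef u m).
Proof. by move=> m0; apply: span_incl; exists u, m. Qed.

Lemma V_C_word_nonneg w x : coef_nonneg x -> vw (rcons w x) = 0.
Proof. by move=> hx; rewrite /V_C_word iword_char // scale0r. Qed.

Lemma V_C_gen_linear : linear gn.
Proof.
move=> a u v; rewrite /V_C_gen coef_linear.
exact: (@iword_linear _ _ (@coef_br _ C) (@coef_nonneg _ C) (fun=> 0) [::]).
Qed.

(** As u(n) kills the vacuum, u(n) v(-1) 1 = [u(n), v(-1)] 1 is the sum of binom(n, k) (u_k v)(n - 1
    - k) 1. The coefficient is zero for k > n and the mode is nonnegative for k < n, so k = n
    remains. *)
Lemma V_C_gen_cprod u (n : nat) v : nprod Y (gn u) n (gn v) = gn (cprod u n v).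
Proof.
rewrite hY.2; set x := coef u n; set y := coef v (-1).
have lw := @iword_linear _ _ (@coef_br _ C) (@coef_nonneg _ C) (fun=> 0) [::].
have -> : vw [:: x; y] = vw [:: coef_br x y].
  rewrite /V_C_word (iword_br _ _ _ [::]) [X in _ - X](@V_C_word_nonneg [:: y] x) ?subr0 //.
  exact: coef_nonneg_coef.
rewrite coef_brE (@fsbig_trunc _ _ n.+1); last first.
  by move=> i ni; rewrite /= bin_small ?scale0r.
rewrite /V_C_word [LHS](linear_sumr lw) big_ord_recr big1 /= => [|i _].
  by rewrite add0r binn scale1r (_ : n%:Z + -1 - n%:Z = -1) //; lia.
rewrite (linear_scale lw) [iword _ _ _ _](@V_C_word_nonneg [::]) ?scaler0 //.
by apply: coef_nonneg_coef; have := ltn_ord i; lia.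
Qed.

Lemma V_C_genT u : gn (cf_T u) = nprod Y (gn u) (-2) (vac Y).
Proof. by rewrite hY.1 hY.2 /V_C_gen coefT scaleN1r opprK. Qed.

Lemma V_C_ind (P : V_C C -> Prop) : P (vac Y) ->
  (forall a x y, P x -> P y -> P (a *: x + y)) ->
  (forall u n v, P v -> P (nprod Y (gn u) n v)) -> forall v, P v.
Proof.
move=> P1 PD PM; apply: iword_ind => //; elim=> [|x w IH]; first by rewrite -[iword _ _ _ _]hY.1.
rewrite -[x]cls_repr; move: (repr x).
have lw := @iword_linear _ _ (@coef_br _ C) (@coef_nonneg _ C) (fun=> 0) w.
apply: fsf_ind => [|a f g Pf Pg|m u].
- rewrite linear0 (linear_at0 lw).
  by have := PD (-1) _ _ P1 P1; rewrite scaleN1r addNr.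
- by rewrite linearP lw; exact: PD.
- by have := PM u m _ IH; rewrite hY.2.
Qed.

Variables (B : Type) (N : B -> B -> nat) (iota : B -> C).
Hypothesis hC : is_conformal_of N iota.

(** The u in C whose image is reached from B form a subspace closed under T, since T u corresponds
    to u_(-2) 1, and under the products of C, which become products of V_C. So all of C is reached,
    and its modes span V_C from the vacuum. *)
Lemma V_C_generated : va_generated Y (range (fun b => gn (iota b))).
Proof.
move=> P P1 PD PM PG.
have P0 : P 0 by have := PD (-1) _ _ P1 P1; rewrite scaleN1r addNr.
have Pgn u : P (gn u).
  have [S SE] : exists S : submodClosed C, forall u, u \in S <-> P (gn u).
    apply: submodClosedE => [|a x y Px Py]; first by rewrite (linear_at0 V_C_gen_linear).
    by rewrite V_C_gen_linear; exact: PD.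
  have [genC _ _] := hC; apply/SE; apply: genC.
  - by move=> b; apply/SE/PG; exists b.
  - by move=> {}u /SE Pu; apply/SE; rewrite V_C_genT; exact: PM.
  - by move=> {}u n v /SE Pu /SE Pv; apply/SE; rewrite -V_C_gen_cprod; exact: PM.
by apply: V_C_ind => // u n v Pv; exact: PM.
Qed.

(** The relations of the coefficient algebra hold in front of every word, hence as identities of
    operators on V_C; [nprod_vanish] turns them into vanishing of products. *)
Lemma V_C_local x y (n : nat) : (N x y <= n)%N ->
  nprod Y (gn (iota x)) n (gn (iota y)) = 0.
Proof.
move=> Nn; apply: (nprod_vanish (N := N x y)) => // w m k; move: w.
have [_ loc _] := hC.
set u := gn _; set v := gn _.
pose F w := \sum_(i < (N x y).+1) (nprod Y u (m - i%:Z) (nprod Y v (k + i%:Z) w)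
  - nprod Y v (k + i%:Z) (nprod Y u (m - i%:Z) w)) *~ ((-1) ^+ i * ('C(N x y, i))%:Z).
suff: forall w, F w = 0 by [].
have lF : linear F.
  move=> a w w'; rewrite /F scaler_sumr -big_split; apply: eq_bigr => i _ /=.
  rewrite -scalerMzr -mulrzDl; congr (_ *~ _).
  rewrite !(nprod_linr Y _ _ a) scalerBr opprD !addrA; congr (_ - _).
  by rewrite addrAC.
apply: iword_ind => [a w w' hw hw'|w]; first by rewrite lF hw hw' scaler0 addr0.
have := loc x y m k => /(congr1 (fun z => vw (z :: w))).
have lw := @iword_linear _ _ (@coef_br _ C) (@coef_nonneg _ C) (fun=> 0) w.
rewrite [LHS](linear_sumr lw) [RHS](linear_at0 lw) => h; rewrite -[RHS]h.
apply: eq_bigr => i _; rewrite (linear_mulz lw) (iword_br _ _ _ [::]).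
by rewrite -![iword _ _ _ _]/(vw _) !hY.2.
Qed.

Variables (W : lmodType K) (Z : vertexAlgebra W) (b : B -> W).
Hypothesis b_local : forall x y (n : nat), (N x y <= n)%N -> nprod Z (b x) n (b y) = 0.

Fact mode_subproof w n : nprod Z w n \in @lin_fun K W.
Proof. by apply/asboolP; exact: nprod_linr. Qed.
Definition mode w n : endo W := Submodule (mode_subproof w n).

(** The reverse passage, in an arbitrary target: vanishing products make the left side of
    [locality_jacobi] zero. *)
Lemma mode_locality : locality N (@lie_br K (endo_lie W)) (fun x n => mode (b x) n).
Proof.
move=> x y n m; apply: endo_ext => w.
have le : linear (fun e : endo W => subval e w) by [].
rewrite (linear_sumr le) /=.
have := locality_jacobi Z (N x y) (b x) (b y) w (n - (N x y)%:Z) m.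
rewrite fsbig1; last first.
  by move=> i _; rewrite -PoszD b_local ?leq_addr // nprod0 mul0rz.
move=> h; rewrite [RHS]h; apply: eq_bigr => i _.
by rewrite (linear_mulz le) /= subrK.
Qed.

(** The modes of [b] extend to an action of the coefficient algebra on [W]. For [induced_hom], every
    u(m) with m >= 0 must kill the vacuum; this holds on generators and spreads to C by closure
    under T and the products. *)
Lemma V_C_universal : exists2 f : V_C C -> W, va_hom Y Z f & forall x, f (gn (iota x)) = b x.
Proof.
have [genC _ univ] := hC.
have [phi [[lphi phiM] phib _]] := univ _ _ mode_locality.
have phi_nn (u : C) (m : nat) : subval (phi (coef u m)) (vac Z) = 0.
  have le : linear (fun e : endo W => subval e (vac Z)) by [].
  have [S SE] : exists S : submodClosed C, forall u, u \in S <->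
      forall m : nat, subval (phi (coef u m)) (vac Z) = 0.
    apply: submodClosedE => [k|a x y hx hy k].
      by rewrite (linear_at0 (coef_linear _)) (linear_at0 lphi).
    by rewrite coef_linear lphi le hx hy scaler0 addr0.
  move: m; apply/SE; apply: genC.
  - by move=> x; apply/SE => m; rewrite phib /= nprod_vac_r.
  (* Here (T u)(m) = - m u(m - 1): the coefficient vanishes for m = 0, and the mode m - 1 is still
     nonnegative for m > 0. *)
  - move=> {}u /SE hu; apply/SE => -[|m].
      by rewrite coefT scale0r oppr0 (linear_at0 lphi).
    rewrite coefT (linear_opp lphi) (linear_scale lphi) (linear_opp le) (linear_scale le).
    by rewrite (_ : m.+1%:Z - 1 = m) ?hu ?scaler0 ?oppr0 //; lia.
  (* (u_n v)(m) is [u(n), v(m)] minus a combination of the (u_k v)(m+n-k), k < n *)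
  - move=> {}u n v /SE hu /SE hv; apply/SE; elim/ltn_ind: n => n IH m.
    have : subval (phi (coef_br (coef u n) (coef v m))) (vac Z) = 0.
      by rewrite phiM /= hu hv !(linear_at0 (endo_linear _)) subrr.
    rewrite coef_brE (@fsbig_trunc _ _ n.+1); last first.
      by move=> i ni; rewrite /= bin_small ?scale0r.
    rewrite (linear_sumr lphi) (linear_sumr le) big_ord_recr big1 => [|i _].
      rewrite /= add0r binn scale1r (_ : n%:Z + m%:Z - n%:Z = m) //; lia.
    rewrite (linear_scale lphi) (linear_scale le).
    have i_n := ltn_ord i; rewrite /=.
    have -> : n%:Z + m%:Z - i%:Z = (n + m - i)%N by lia.
    by rewrite IH // scaler0.
have [||||f [lf f1 fM]] := @induced_hom _ _ (@coef_br _ C) (@coef_nonneg _ C) (fun=> 0)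
    W (fun x w => subval (phi x) w) (vac Z).
- by move=> w a x y; rewrite lphi.
- by move=> x; exact: endo_linear.
- by move=> x y w; rewrite phiM.
- move=> p hp; rewrite scale0r; move: p hp.
  apply: (@span_ind K (coef_alg C) _ (fun p => subval (phi p) (vac Z) = 0)).
  + by rewrite (linear_at0 lphi).
  + move=> a x y hx hy; rewrite lphi.
    transitivity (a *: subval (phi x) (vac Z) + subval (phi y) (vac Z)) => //.
    by rewrite hx hy scaler0 addr0.
  + by move=> _ [u [[m|m] [m0 ->]]].
have fgn x : f (gn (iota x)) = b x.
  by rewrite /V_C_gen /V_C_word fM f1 phib /= nprod_creation.
exists f => //; apply: (va_hom_generated V_C_generated lf).
  by rewrite hY.1.
move=> _ n v [x _ <-]; rewrite fgn; move: v; apply: iword_ind.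
  by move=> a v w hv hw; rewrite !(nprod_linr _ _ n a) !lf (nprod_linr _ _ n a) hv hw.
by move=> w; rewrite -[iword _ _ _ _]/(vw w) hY.2 /V_C_word fM phib.
Qed.

End ConformalVertexAlgebra.

(** * Operator products with at most a double pole *)

Lemma binz0 m : binz m 0 = 1.
Proof. by case: m => p; rewrite /= bin0. Qed.

Lemma binz1 m : binz m 1 = m.
Proof. by case: m => p; rewrite /= bin1 // addn1 mulN1r NegzE. Qed.

Section OperatorProducts.
Variables (K : numFieldType) (V : lmodType K) (Y : vertexAlgebra V).
Local Notation np := (nprod Y).

(* u(z) v ~ w / z + c 1 / z^2; such operator product expansions determine the affine
   commutation relations. *)
Definition ope (u v w : V) (c : K) : Prop := forall n : nat,
  np u n v = if n is n'.+1 then (if n' is 0%N then c *: vac Y else 0) else w.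

Lemma ope_skew u v w c : ope u v w c -> ope v u (- w) c.
Proof.
move=> h n; rewrite (@nprod_skew _ _ Y u v); last first.
  case=> // -[|j] _; first by exists c; rewrite h.
  by exists 0; rewrite h scale0r.
rewrite h; case: n => [|[|n]]; rewrite ?scaler0 //.
  by rewrite expr1 scaleN1r.
by rewrite expr2 mulrNN mulr1 scale1r.
Qed.

Lemma ope0l v : ope 0 v 0 0.
Proof. by move=> [|[|n]]; rewrite nprod0 ?scale0r. Qed.

Lemma ope_linl a u u' v w w' c c' : ope u v w c -> ope u' v w' c' ->
  ope (a *: u + u') v (a *: w + w') (a * c + c').
Proof.
move=> h h' n; rewrite (nprod_linl Y n v) h h'; case: n => [|[|n]] //.
  by rewrite scalerA scalerDl.
by rewrite scaler0 addr0.
Qed.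

Lemma ope_linr a u v v' w w' c c' : ope u v w c -> ope u v' w' c' ->
  ope u (a *: v + v') (a *: w + w') (a * c + c').
Proof.
move=> h h' n; rewrite (nprod_linr Y u n) h h'; case: n => [|[|n]] //.
  by rewrite scalerA scalerDl.
by rewrite scaler0 addr0.
Qed.

Lemma ope_oppl u v w c : ope u v w c -> ope (- u) v (- w) (- c).
Proof. by move=> h [|[|n]]; rewrite nprodNl h ?scaleNr ?oppr0. Qed.

Lemma ope_oppr u v w c : ope u v w c -> ope u (- v) (- w) (- c).
Proof. by move=> h [|[|n]]; rewrite nprodNr h ?scaleNr ?oppr0. Qed.

Lemma ope_commutator u v w c m k z : ope u v w c ->
  np u m (np v k z) - np v k (np u m z) =
  np w (m + k) z + (m%:~R * (m + k == 0)%:R * c) *: z.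
Proof.
move=> h; rewrite (@nprod_commutator _ _ Y u v z m k 2); last first.
  by case=> [|[|i]] // _; rewrite h.
rewrite big_ord_recr big_ord1 /= !h binz0 binz1 mulr1z subr0; congr (_ + _).
rewrite nprodZl nprod_vac -scaler_int scalerA -mulrA; case: (m + k =P 0) => [->|mk0].
  by rewrite sub0r eqxx mul1r.
by case: eqP => [|_]; rewrite ?mul0r ?mulr0 ?scaler0 ?scale0r //; lia.
Qed.

(* u_n commutes with x_0 up to w1_n, since the central term of [u(n), x(0)] is
   n delta_(n,0) c1 = 0. *)
Lemma ope_bracketr u x y w1 c1 w2 c2 w3 c3 :
  ope u x w1 c1 -> ope u y w2 c2 -> ope w1 y w3 c3 ->
  ope u (np x 0 y) (np x 0 w2 + w3) c3.
Proof.
move=> h1 h2 h3 n.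
have /eqP := ope_commutator n 0 y h1; rewrite subr_eq addr0 => /eqP ->.
rewrite h2 h3; have -> : n%:~R * (n%:Z == 0)%:R * c1 = 0.
  by case: n => [|n]; rewrite ?mul0r // mulr0 mul0r.
case: n => [|[|n]]; rewrite ?scale0r ?addr0 ?nprodZr ?nprod_vac_r ?nprod0r ?addr0 //.
- by rewrite addrC.
- by rewrite scaler0 addr0.
Qed.

(** By derivation, (x_0 y)_n v = x_0 (y_n v) - y_n (x_0 v). Since x_0 kills the vacuum, [c2]
    disappears and only [c3] reaches the double pole. *)
Lemma ope_bracketl x y v w1 c1 w2 c2 w3 c3 :
  ope x v w1 c1 -> ope y v w2 c2 -> ope y w1 w3 c3 ->
  ope (np x 0 y) v (np x 0 w2 - w3) (- c3).
Proof.
move=> h1 h2 h3 n.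
have /eqP := nprod0_derivation Y x y v n; rewrite -subr_eq => /eqP <-.
rewrite [np x 0 v](h1 0%N) h2 h3; case: n => [|[|n]] //.
  by rewrite nprodZr (nprod_vac_r Y x 0) scaler0 sub0r scaleNr.
by rewrite nprod0r subr0.
Qed.

End OperatorProducts.

(** * The Lie algebra sl *)

Section Matrices.
Variable K : numFieldType.
Local Notation gl := (fsf (int * int)%type (K^o)).
Local Notation matE := (matE K).

Lemma gl_mul_bilinear : (forall b : gl, linear (fun a => gl_mul a b)) /\
  (forall a : gl, linear (gl_mul a)).
Proof.
pose B (p q : int * int) (x y : K^o) : gl :=
  mono (p.1, q.2) ((p.2 == q.1)%:R * (x * y) : K^o).
apply: (biext_linear (B := B)) => p q x a y z; rewrite /B -(mono_linear (p.1, q.2) a);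
  congr (mono _ _); rewrite -[a *: _ in RHS]/(a * _) -[a *: _ in LHS]/(a * _); ring.
Qed.

Lemma gl_mul_linl b : linear (fun a : gl => gl_mul a b).
Proof. exact: gl_mul_bilinear.1. Qed.
Lemma gl_mul_linr a : linear (gl_mul a : gl -> gl).
Proof. exact: gl_mul_bilinear.2. Qed.

Lemma gl_form_bilinear : (forall b : gl, linear (fun a => gl_form a b : K^o)) /\
  (forall a : gl, linear (gl_form a : gl -> K^o)).
Proof.
pose B (p q : int * int) (x y : K^o) : K^o :=
  ((p.1 == q.2) && (p.2 == q.1))%:R * (x * y).
apply: (biext_linear (B := B)) => p q x a y z; rewrite /B;
  rewrite -![a *: _]/(a * _); ring.
Qed.

Lemma gl_form_linl b : linear (fun a : gl => gl_form a b : K^o).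
Proof. exact: gl_form_bilinear.1. Qed.
Lemma gl_form_linr a : linear (gl_form a : gl -> K^o).
Proof. exact: gl_form_bilinear.2. Qed.

Lemma gl_ind (P : gl -> Prop) :
  (forall a x y, P x -> P y -> P (a *: x + y)) -> (forall i j, P (matE i j)) ->
  forall x, P x.
Proof.
move=> PD PE.
have P0 : P 0 by have := PD (-1) _ _ (PE 0 0) (PE 0 0); rewrite scaleN1r addNr.
apply: fsf_ind => // -[i j] c.
have -> : mono (i, j) c = c *: matE i j + 0.
  by rewrite addr0 -(linear_scale (mono_linear _)) /GRing.scale /= mulr1.
exact: PD.
Qed.

Lemma gl_mulA (a b c : gl) : gl_mul a (gl_mul b c) = gl_mul (gl_mul a b) c.
Proof.
move: a; apply: gl_ind => [k x y hx hy|i j].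
  by rewrite (gl_mul_linl (gl_mul b c) k) hx hy (gl_mul_linl b k) (gl_mul_linl c k).
move: b; apply: gl_ind => [k x y hx hy|i' j'].
  by rewrite (gl_mul_linl c k) !(gl_mul_linr _ k) hx hy (gl_mul_linl c k).
move: c; apply: gl_ind => [k x y hx hy|i'' j''].
  by rewrite !(gl_mul_linr _ k) hx hy.
rewrite !gl_mul_matE (linear_scale (gl_mul_linr _)) (linear_scale (gl_mul_linl _)).
by rewrite !gl_mul_matE !scalerA mulrC.
Qed.

Lemma gl_formC (a b : gl) : gl_form a b = gl_form b a.
Proof.
move: a; apply: gl_ind => [k x y hx hy|i j].
  by rewrite (gl_form_linl b k) hx hy (gl_form_linr b k).
move: b; apply: gl_ind => [k x y hx hy|i' j'].
  by rewrite (gl_form_linr _ k) hx hy (gl_form_linl _ k).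
by rewrite !gl_form_matE andbC [i == _]eq_sym [j == _]eq_sym.
Qed.

Lemma gl_form_mul (a b c : gl) : gl_form (gl_mul a b) c = gl_form a (gl_mul b c).
Proof.
move: a; apply: gl_ind => [k x y hx hy|i j].
  by rewrite (gl_mul_linl b k) !(gl_form_linl _ k) hx hy.
move: b; apply: gl_ind => [k x y hx hy|i' j'].
  by rewrite (gl_mul_linl c k) !(gl_mul_linr _ k) (gl_form_linl _ k) hx hy (gl_form_linr _ k).
move: c; apply: gl_ind => [k x y hx hy|i'' j''].
  by rewrite !(gl_mul_linr _ k) !(gl_form_linr _ k) hx hy.
rewrite !gl_mul_matE (linear_scale (gl_form_linr _)) (linear_scale (gl_form_linl _)).
rewrite !gl_form_matE /GRing.scale /= -!natrM !mulnb; congr (_%:R).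
by case: (j == i'); case: (j' == i''); case: (i == j'').
Qed.

Lemma gl_br_linl b : linear (fun a : gl => gl_br a b).
Proof.
move=> k x y; rewrite /gl_br (gl_mul_linl b k) (gl_mul_linr b k) scalerBr opprD !addrA.
by congr (_ - _); rewrite addrAC.
Qed.

Lemma gl_brC (a b : gl) : gl_br a b = - gl_br b a.
Proof. by rewrite /gl_br opprB. Qed.

Lemma gl_br_linr a : linear (gl_br a : gl -> gl).
Proof.
by move=> k x y; rewrite gl_brC (gl_br_linl a k) opprD -scalerN -!gl_brC.
Qed.

Lemma gl_jacobi (a b c : gl) :
  gl_br (gl_br a b) c = gl_br a (gl_br b c) - gl_br b (gl_br a c).
Proof.
rewrite /gl_br !(linear_sub (gl_mul_linl _)) !(linear_sub (gl_mul_linr _)) !gl_mulA.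
rewrite !opprB !addrA [RHS](ACl ((1*8*3*6)*(2*5)*(7*4))) /=.
by rewrite addNr subrr !addr0.
Qed.

Lemma gl_form_br (a b c : gl) : gl_form (gl_br a b) c = - gl_form b (gl_br a c).
Proof.
rewrite /gl_br (linear_sub (gl_form_linl _)) (linear_sub (gl_form_linr _)) opprB.
by rewrite -!gl_form_mul [gl_form (gl_mul b c) a]gl_formC -gl_form_mul.
Qed.

Lemma gl_br_matE i j k l : gl_br (matE i j) (matE k l) =
  (j == k)%:R *: matE i l - (l == i)%:R *: matE k j.
Proof. by rewrite /gl_br !gl_mul_matE. Qed.

(** The Cartan matrix as the Gram matrix (eps_i - eps_(i+1), eps_j - eps_(j+1)), which is the shape
    produced by brackets and traces of matrix units. *)
Lemma cartanE i j : cartan i j =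
  (i == j)%:Z + (i + 1 == j + 1)%:Z - (j + 1 == i)%:Z - (i + 1 == j)%:Z.
Proof.
rewrite /cartan; case: (i =P j); case: (j =P i + 1); case: (j =P i - 1);
  case: (i + 1 =P j + 1); case: (j + 1 =P i); case: (i + 1 =P j) => //=; lia.
Qed.

Lemma gl_br_raise_cartan k i :
  gl_br (matE k (k + 1)) (matE i i - matE (i + 1) (i + 1)) =
  - (cartan i k)%:~R *: matE k (k + 1).
Proof.
rewrite (linear_sub (gl_br_linr _)) !gl_br_matE.
(* Wherever its Kronecker delta is nonzero, a matrix unit occurring here is E_(k,k+1), so only
   integer coefficients of one matrix remain to be compared. *)
have e (b : bool) p q : (b -> p = k /\ q = k + 1) ->
    b%:R *: matE p q = b%:~R *: matE k (k + 1).
  by case: b => [[] // -> ->|_]; rewrite ?scale0r.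
rewrite !e; try by move/eqP; lia.
rewrite -!scalerBl -!intrB -intrN cartanE [k + 1 == i + 1]eq_sym; congr (_%:~R *: _); lia.
Qed.

Lemma gl_br_lower_cartan k i :
  gl_br (matE (k + 1) k) (matE i i - matE (i + 1) (i + 1)) =
  (cartan i k)%:~R *: matE (k + 1) k.
Proof.
rewrite (linear_sub (gl_br_linr _)) !gl_br_matE.
have e (b : bool) p q : (b -> p = k + 1 /\ q = k) ->
    b%:R *: matE p q = b%:~R *: matE (k + 1) k.
  by case: b => [[] // -> ->|_]; rewrite ?scale0r.
rewrite !e; try by move/eqP; lia.
rewrite -!scalerBl -!intrB cartanE [k == i]eq_sym [k == i + 1]eq_sym.
by congr (_%:~R *: _); lia.
Qed.

Lemma gl_form_diag i j k : i != j -> gl_form (matE i j) (matE k k) = 0.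
Proof.
move=> ij; rewrite gl_form_matE (_ : _ && _ = false) //.
by apply/negP => /andP[/eqP ik /eqP jk]; rewrite ik jk eqxx in ij.
Qed.

(** A commutator of two matrix units is zero, an off-diagonal unit up to sign, or some E_(i,i) -
    E_(j,j), which telescopes into the H_k. *)
Lemma sl_span_ind (Q : gl -> Prop) :
  (forall a x y, Q x -> Q y -> Q (a *: x + y)) ->
  (forall i j, i != j -> Q (matE i j)) ->
  (forall i, Q (matE i i - matE (i + 1) (i + 1))) ->
  forall a, a \in span (@gl_commutators K) -> Q a.
Proof.
move=> QD QE QH.
have Q0 : Q 0 by have := QD (-1) _ _ (QH 0) (QH 0); rewrite scaleN1r addNr.
have QN x : Q x -> Q (- x).
  by move=> Qx; rewrite -[- x]addr0 -scaleN1r; exact: QD.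
have QDD x y : Q x -> Q y -> Q (x + y).
  by move=> Qx Qy; rewrite -[x]scale1r; exact: QD.
have QHd i (d : nat) : Q (matE i i - matE (i + d%:Z) (i + d%:Z)).
  elim: d => [|d IH]; first by rewrite addr0 subrr.
  rewrite -addn1 PoszD addrA -(subrKA (matE (i + d%:Z) (i + d%:Z))).
  exact: QDD.
have QHH i j : Q (matE i i - matE j j).
  wlog ij : i j / i <= j.
    move=> h; have [/h //|/ltW/h] := lerP i j.
    by rewrite -[X in _ -> X]/(Q _) => /QN; rewrite opprB.
  by have -> : j = i + `|j - i|%N%:Z by lia.
apply: span_ind => // _ [a [b ->]].
move: a; apply: gl_ind => [k x y hx hy|i j]; first by rewrite gl_br_linl; exact: QD.
move: b; apply: gl_ind => [k x y hx hy|k l]; first by rewrite gl_br_linr; exact: QD.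
rewrite gl_br_matE; case: (j =P k) => [<-|/eqP jk]; case: (l =P i) => [->|/eqP li];
  rewrite ?scale1r ?scale0r ?subr0 ?sub0r //.
- by apply: QE; rewrite eq_sym.
- by apply/QN/QE; rewrite eq_sym.
Qed.

Lemma sl_gen_ind (Q : gl -> Prop) :
  (forall a x y, Q x -> Q y -> Q (a *: x + y)) ->
  (forall i, Q (matE i (i + 1))) -> (forall i, Q (matE (i + 1) i)) ->
  (forall a b, Q a -> Q b -> Q (gl_br a b)) ->
  forall a, a \in span (@gl_commutators K) -> Q a.
Proof.
move=> QD Qx Qy QM; apply: sl_span_ind => // [i j ij|i]; last first.
  have := QM _ _ (Qx i) (Qy i); rewrite gl_br_matE !eqxx !scale1r.
  exact.
have up (d : nat) k : Q (matE k (k + 1 + d%:Z)).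
  elim: d => [|d IH]; first by rewrite addr0.
  have := QM _ _ IH (Qx (k + 1 + d%:Z)); rewrite gl_br_matE eqxx scale1r.
  rewrite (_ : _ == k = false) ?scale0r ?subr0; last by apply/eqP; lia.
  by rewrite (_ : k + 1 + d.+1%:Z = k + 1 + d%:Z + 1) //; lia.
have dn (d : nat) k : Q (matE (k + 1 + d%:Z) k).
  elim: d => [|d IH]; first by rewrite addr0.
  have := QM _ _ (Qy (k + 1 + d%:Z)) IH; rewrite gl_br_matE eqxx scale1r.
  rewrite (_ : _ == _ + 1 = false) ?scale0r ?subr0; last by apply/eqP; lia.
  by rewrite (_ : k + 1 + d.+1%:Z = k + 1 + d%:Z + 1) //; lia.
have [le|le] := lerP i j.
  by have -> : j = i + 1 + (absz (j - i - 1)%R)%:Z by move/eqP: ij; lia.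
by have -> : i = j + 1 + (absz (i - j - 1)%R)%:Z by lia.
Qed.

End Matrices.

(** * The affine vertex algebra *)

Section AffineVertexAlgebra.
Variables (K : numFieldType) (l : K) (Y : vertexAlgebra (V_aff l)).
Hypothesis hY : is_V_aff Y.
Local Notation vw := (V_aff_word l).
Local Notation gn := (V_aff_gen l).
Local Notation gl := (fsf (int * int)%type (K^o)).

Lemma aff_mono_linear m : linear (fun a : sl K => aff_mono a m).
Proof. by move=> k a b; congr (_, _); rewrite ?mono_linear //= scaler0 addr0. Qed.

Lemma aff_nonneg_mono (a : sl K) m (c : K^o) : 0 <= m -> aff_nonneg (mono m a, c).
Proof. by move=> m0 n n0; rewrite /fsf_val /=; case: eqP => // nm; lia. Qed.

Lemma V_aff_word_nonneg w p : aff_nonneg p -> vw (rcons w p) = (l * p.2) *: vw w.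
Proof. by move=> hp; rewrite /V_aff_word iword_char. Qed.

Lemma V_aff_word_linear w : linear (fun x => vw (x :: w)).
Proof. exact: iword_linear. Qed.

Lemma V_aff_word_br x y w : vw (aff_br x y :: w) = vw (x :: y :: w) - vw (y :: x :: w).
Proof. exact: (iword_br _ _ _ [::]). Qed.

Lemma V_aff_gen_linear : linear gn.
Proof. by move=> k a b; rewrite /V_aff_gen aff_mono_linear V_aff_word_linear. Qed.

(** As a(n) kills the vacuum, a(n) b(-1) 1 = [a(n), b(-1)] 1. For n = 0 this is [a, b](-1) 1; for n
    > 0 the loop part has a nonnegative mode and dies, leaving the cocycle n delta_(n,1) (a, b)
    l. *)
Lemma V_aff_ope a b :
  ope Y (gn a) (gn b) (gn (sl_br a b)) (l * gl_form (subval a) (subval b)).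
Proof.
move=> n; rewrite hY.2; set x := aff_mono a n; set y := aff_mono b (-1).
have -> : vw [:: x; y] = vw [:: aff_br x y].
  have h : vw [:: y; x] = 0.
    rewrite [LHS](@V_aff_word_nonneg [:: y] x); last exact: aff_nonneg_mono.
    by rewrite [x.2]/(0 : K^o) mulr0 scale0r.
  by rewrite V_aff_word_br h subr0.
rewrite aff_brE hY.1; case: n x => [|n] _.
  by rewrite add0r mul0r mul0r.
rewrite (@V_aff_word_nonneg [::]); last by apply: aff_nonneg_mono; lia.
rewrite /= (_ : (n.+1%:Z - 1 == 0) = (n == 0%N)); last by apply/eqP/eqP; lia.
by case: n => [|n]; rewrite ?mulr1 ?mul1r // mulr0 mul0r mulr0 scale0r.
Qed.

Lemma sl_br_linl b : linear (fun a : sl K => sl_br a b).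
Proof. by move=> k x y; apply: val_inj; rewrite /= gl_br_linl. Qed.

Lemma sl_br_linr a : linear (sl_br a : sl K -> sl K).
Proof. by move=> k x y; apply: val_inj; rewrite /= gl_br_linr. Qed.

Lemma aff_br_central (c : K^o) (x : aff_sl K) : aff_br (0, c) x = 0.
Proof.
congr (_, _); rewrite fsbig1 // => i _; rewrite fsbig1 // => j _.
  by rewrite (linear_at0 (sl_br_linl _)) (linear_at0 (mono_linear _)).
by rewrite (linear_at0 (gl_form_linl _)) mulr0.
Qed.

(** The character only evaluates the last letter of a word. A central letter is carried there past
    each letter on its right, whence the arbitrary prefix in the induction. *)
Lemma V_aff_central (c : K^o) w : vw ((0, c) :: w) = (l * c) *: vw w.
Proof.
have nn : @aff_nonneg K (0, c) by [].
suff: forall u, vw (u ++ (0, c) :: w) = (l * c) *: vw (u ++ w) by move=> /(_ [::]).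
elim: w => [|y w IH] u; first by rewrite cats1 cats0 V_aff_word_nonneg.
rewrite -[in RHS]cat_rcons -IH cat_rcons; apply/eqP; rewrite -subr_eq0; apply/eqP.
rewrite -[LHS](iword_br _ _ _ u) aff_br_central.
(* A word with a letter 0 vanishes: linearity applied to -1 *: 0 + 0. *)
have := iword_lin (@aff_br K) (@aff_nonneg K) (fun x => l * x.2) u w (-1) 0 0.
by rewrite scaler0 addr0 scaleN1r addNr.
Qed.

Lemma V_aff_ind (P : V_aff l -> Prop) : P (vac Y) ->
  (forall a x y, P x -> P y -> P (a *: x + y)) ->
  (forall a n v, P v -> P (nprod Y (gn a) n v)) -> forall v, P v.
Proof.
move=> P1 PD PM; apply: iword_ind => //; elim=> [|[f c] w IH].
  by rewrite -[iword _ _ _ _]hY.1.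
have P0 : P 0 by have := PD (-1) _ _ P1 P1; rewrite scaleN1r addNr.
have -> : ((f, c) : aff_sl K) = 1 *: (f, 0) + (0, c).
  by congr (_, _); rewrite /= scale1r ?addr0 ?add0r.
rewrite iword_linear -[X in _ + X]/(vw _) V_aff_central; apply: (PD); last first.
  by rewrite -[_ *: _]addr0; exact: PD.
move: f; apply: fsf_ind => [|a f g Pf Pg|m a].
- by rewrite -[iword _ _ _ _]/(vw _) (linear_at0 (V_aff_word_linear w)).
- have -> : ((a *: f + g, 0) : aff_sl K) = a *: (f, 0) + (g, 0).
    by congr (_, _); rewrite /= ?scaler0 addr0.
  by rewrite iword_linear; exact: PD.
- by have := PM a m _ IH; rewrite hY.2.
Qed.

Definition V_aff_simple_roots : set (V_aff l) :=
  [set v | exists s i, v = gn (slX K s i)].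

Lemma V_aff_generated : va_generated Y V_aff_simple_roots.
Proof.
move=> P P1 PD PM PG.
suff Pgn (a : sl K) : P (gn a) by apply: V_aff_ind => // a n v Pv; exact: PM.
have [b /val_inj -> //] : exists2 b : sl K, subval a = subval b & P (gn b).
move: (subval a) (subvalP a) => {a}.
apply: sl_gen_ind => [k x y [a -> Pa] [b -> Pb]|i|i|x y [a -> Pa] [b -> Pb]].
- by exists (k *: a + b) => //; rewrite V_aff_gen_linear; exact: PD.
- by exists (slX K true i) => //; apply: PG; exists true, i.
- by exists (slX K false i) => //; apply: PG; exists false, i.
- by exists (sl_br a b) => //; rewrite -(V_aff_ope a b 0%N); exact: PM.
Qed.

End AffineVertexAlgebra.

(** * Root vectors from Chevalley generators *)

Section ChevalleyFamilies.
Variables (K : numFieldType) (V : lmodType K) (Y : vertexAlgebra V) (l : K).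
Local Notation np := (nprod Y).
Local Notation ope := (ope Y).

(** Chevalley and Serre relations as operator products. Pairs of equal sign have at most a simple
    pole with unspecified coefficient; the Serre relations then constrain it, according as the
    Cartan entry is -1 or one of 0 and 2. *)
Record chevalley (x y h : int -> V) : Prop := Chevalley {
  chevalley_hx : forall i j, ope (h i) (x j) ((cartan i j)%:~R *: x j) 0;
  chevalley_hy : forall i j, ope (h i) (y j) (- ((cartan i j)%:~R *: y j)) 0;
  chevalley_xy : forall i j, ope (x i) (y j) ((i == j)%:R *: h i) ((i == j)%:R * l);
  chevalley_xx : forall i j, ope (x i) (x j) (np (x i) 0 (x j)) 0;
  chevalley_yy : forall i j, ope (y i) (y j) (np (y i) 0 (y j)) 0;
  chevalley_xx0 : forall i j, cartan i j != -1 -> np (x i) 0 (x j) = 0;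
  chevalley_yy0 : forall i j, cartan i j != -1 -> np (y i) 0 (y j) = 0;
  chevalley_xxx : forall i j, cartan i j = -1 -> np (x i) 0 (np (x i) 0 (x j)) = 0;
  chevalley_yyy : forall i j, cartan i j = -1 -> np (y i) 0 (np (y i) 0 (y j)) = 0 }.

(* the Chevalley involution *)
Lemma chevalley_opp x y h : chevalley x y h ->
  chevalley (fun i => - y i) (fun i => - x i) (fun i => - h i).
Proof.
case=> hx hy xy xx yy xx0 yy0 xxx yyy; split=> i j /=.
- by have := ope_oppl (ope_oppr (hy i j)); rewrite !oppr0 !opprK scalerN.
- by have := ope_oppl (ope_oppr (hx i j)); rewrite !oppr0 opprK scalerN opprK.
- have := ope_oppl (ope_oppr (ope_skew (xy j i))); rewrite !opprK eq_sym scalerN.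
  by case: eqP => [->|_] //; rewrite !scale0r.
- by rewrite nprodNl nprodNr opprK; have := ope_oppl (ope_oppr (yy i j)); rewrite !opprK.
- by rewrite nprodNl nprodNr opprK; have := ope_oppl (ope_oppr (xx i j)); rewrite !opprK.
- by move/yy0; rewrite nprodNl nprodNr opprK.
- by move/xx0; rewrite nprodNl nprodNr opprK.
- by move/yyy; rewrite !nprodNl !nprodNr !opprK => ->; rewrite oppr0.
- by move/xxx; rewrite !nprodNl !nprodNr !opprK => ->; rewrite oppr0.
Qed.

Lemma ope_commute u x y w c1 c2 :
  ope u x 0 c1 -> ope u y w c2 -> ope u (np x 0 y) (np x 0 w) 0.
Proof.
by move=> ux uy; have := ope_bracketr ux uy (ope0l Y y); rewrite addr0.
Qed.

Lemma ope_commute0 u x y : ope u x 0 0 -> ope u y 0 0 -> ope u (np x 0 y) 0 0.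
Proof. by move=> ux uy; rewrite -[X in ope _ _ X](nprod0r Y x 0); exact: ope_commute uy. Qed.

(* the image of E_(i, i+d+1) *)
Fixpoint rootv (x : int -> V) (i : int) (d : nat) : V :=
  if d is d'.+1 then np (x i) 0 (rootv x (i + 1) d') else x i.

Section RootVectors.
Variables x y h : int -> V.
Hypothesis ch : chevalley x y h.
Local Notation e := (rootv x).

Lemma simple_far k i : k != i + 1 -> k + 1 != i -> ope (x k) (x i) 0 0.
Proof.
move=> h1 h2; have := chevalley_xx ch k i; rewrite (chevalley_xx0 ch) //.
rewrite /cartan; case: (k == i) => //; case: ifP => // /orP[]/eqP; move/eqP: h1; move/eqP: h2; lia.
Qed.

Lemma simple_near i : ope (x i) (x (i + 1)) (e i 1) 0.
Proof. exact: (chevalley_xx ch). Qed.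

Lemma cartan_succ i : cartan i (i + 1) = -1.
Proof. by rewrite /cartan eqxx /=; case: eqP => //; lia. Qed.

Lemma cartan_pred i : cartan (i + 1) i = -1.
Proof. by rewrite /cartan addrK eqxx orbT; case: eqP => //; lia. Qed.

Lemma cartan_far i j : j != i -> j != i + 1 -> j + 1 != i -> cartan i j = 0.
Proof.
move=> /eqP h1 /eqP h2 /eqP h3; rewrite /cartan; case: eqP => [|_]; first by lia.
by case: eqP => [|_]; case: eqP => [|_] //=; lia.
Qed.

(** The Serre relation concerns the 0-th product alone; [ope_commute] supplies the vanishing of the
    higher ones. *)
Lemma simple_serre_l i : ope (x i) (e i 1) 0 0.
Proof.
have ii : ope (x i) (x i) 0 0 by apply: simple_far; apply/eqP; lia.
have := ope_commute ii (simple_near i).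
by rewrite /= (chevalley_xxx ch) // cartan_succ.
Qed.

Lemma simple_serre_r i : ope (x (i + 1)) (e i 1) 0 0.
Proof.
have ii : ope (x (i + 1)) (x (i + 1)) 0 0 by apply: simple_far; apply/eqP; lia.
have := ope_commute ii (chevalley_xx ch (i + 1) i).
rewrite (chevalley_xxx ch) ?cartan_pred // => /ope_oppr; rewrite !oppr0.
by rewrite (ope_skew (simple_near i) 0%N) opprK.
Qed.

Lemma simple_root_far k i d : (k + 1 < i) || (i + d%:Z + 1 < k) -> ope (x k) (e i d) 0 0.
Proof.
elim: d i => [|d IH] i ki; first by apply: simple_far; apply/eqP; lia.
apply: ope_commute0; first by apply: simple_far; apply/eqP; lia.
by apply: IH; lia.
Qed.

Lemma double_root_pre k d :
  ope (x (k + 1)) (e (k + 1 + 1) d) (e (k + 1) d.+1) 0 ->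
  ope (e k 1) (e (k + 1 + 1) d) (e k d.+2) 0.
Proof.
move=> h1; have h2 : ope (x k) (e (k + 1 + 1) d) 0 0 by apply: simple_root_far; lia.
have h3 : ope (x (k + 1)) 0 0 0 by have := ope_skew (ope0l Y (x (k + 1))); rewrite oppr0.
by have := ope_bracketl h2 h1 h3; rewrite subr0 oppr0.
Qed.

(** The 0-th product is the definition of [rootv]; the content is that no higher product occurs. In
    the induction x_k commutes with [e (k + 1 + 1) d], so only its bracket with x_(k+1)
    contributes. *)
Lemma simple_root_pre k d : ope (x k) (e (k + 1) d) (e k d.+1) 0.
Proof.
elim: d k => [|d IH] k; first exact: simple_near.
have h2 : ope (x k) (e (k + 1 + 1) d) 0 0 by apply: simple_root_far; lia.
have := ope_bracketr (simple_near k) h2 (double_root_pre (IH (k + 1))).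
by rewrite nprod0r add0r.
Qed.

Lemma simple_root_post i d : ope (x (i + d%:Z + 1)) (e i d) (- e i d.+1) 0.
Proof.
elim: d i => [|d IH] i; first by rewrite addr0; apply/ope_skew/simple_near.
have h1 : ope (x (i + d.+1%:Z + 1)) (x i) 0 0 by apply: simple_far; apply/eqP; lia.
have := ope_commute h1; rewrite (_ : i + d.+1%:Z + 1 = i + 1 + d%:Z + 1); last by lia.
by move/(_ _ _ _ (IH (i + 1))); rewrite nprodNr.
Qed.

(* The two ways of expanding x_(i+1) against [x_i, [x_(i+1), x_(i+2)]] give A = - A for
   the 0-th product A. *)
Lemma simple_root_mid i : ope (x (i + 1)) (e i 2) 0 0.
Proof.
set A := np (x (i + 1)) 0 (e i 2).
have h1 : ope (e i 1) (x (i + 1)) 0 0.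
  by have := ope_skew (simple_serre_r i); rewrite oppr0.
have h2 : ope (e i 1) (x (i + 1 + 1)) (e i 2) 0.
  by apply: (@double_root_pre _ 0); exact: simple_near.
have h3 : ope (- e i 1) (e (i + 1) 1) (- A) 0.
  by rewrite -[X in ope _ _ _ X]oppr0; apply: ope_oppl; exact: ope_commute h2.
have := ope_bracketr (ope_skew (simple_near i)) (simple_serre_l (i + 1)) h3.
rewrite nprod0r add0r => h4; have A0 : A = 0.
  have /eqP := h4 0%N; rewrite -addr_eq0 -mulr2n -scaler_nat scaler_eq0 pnatr_eq0 /=.
  by move/eqP.
by rewrite -[X in ope _ _ X]oppr0 -{1}A0.
Qed.

(** The nested bracket is regrouped so that x_k commutes with each factor: for k = i the first two
    letters form one factor, for k = i + 1 the last letter is split off, for larger k the first one.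
    Two letters are the Serre relations, and the middle of three is [simple_root_mid]. *)
Lemma simple_root_in k i d : i <= k <= i + d%:Z -> ope (x k) (e i d) 0 0.
Proof.
elim: d i k => [|d IH] i k ki; first by apply: simple_far; apply/eqP; lia.
case: d IH ki => [|d] IH ki.
  have [->|->] : k = i \/ k = i + 1 by lia.
    exact: simple_serre_l.
  exact: simple_serre_r.
have [->|ki'] := eqVneq k i.
  have -> : e i d.+2 = np (e i 1) 0 (e (i + 1 + 1) d).
    rewrite /= nprod0_derivation [X in _ + np _ _ X](@simple_root_far _ _ _ _ 0%N); last by lia.
    by rewrite nprod0r addr0.
  by apply: ope_commute0; [exact: simple_serre_l|apply: simple_root_far; lia].
have [->|ki''] := eqVneq k (i + 1).
  case: d IH ki => [|d] IH ki; first exact: simple_root_mid.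
  have -> : e i d.+3 = - np (x (i + d.+2%:Z + 1)) 0 (e i d.+2).
    by rewrite (simple_root_post i d.+2 0%N) opprK.
  rewrite -[X in ope _ _ X]oppr0 -[X in ope _ _ _ X]oppr0; apply: ope_oppr.
  apply: ope_commute0; first by apply: simple_far; apply/eqP; lia.
  by apply: IH; lia.
apply: ope_commute0; first by apply: simple_far; apply/eqP; lia.
by apply: IH; lia.
Qed.

Lemma simple_root k i d : ope (x k) (e i d)
  ((k + 1 == i)%:R *: e k d.+1 - (k == i + d%:Z + 1)%:R *: e i d.+1) 0.
Proof.
case: (k + 1 =P i) => [<-|ki].
  rewrite (_ : _ == _ = false); last by apply/eqP; lia.
  by rewrite scale1r scale0r subr0; exact: simple_root_pre.
case: eqP => [->|kj]; rewrite scale0r sub0r.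
  by rewrite scale1r; exact: simple_root_post.
rewrite scale0r oppr0.
have [|] := boolP (i <= k <= i + d%:Z); first exact: simple_root_in.
by move=> h1; apply: simple_root_far; lia.
Qed.

Lemma cartan_root_far k i d : k + 1 < i -> ope (h k) (e i d) 0 0.
Proof.
elim: d i => [|d IH] i ki; last first.
  apply: ope_commute0; last by apply: IH; lia.
  have := chevalley_hx ch k i; rewrite cartan_far ?scale0r //; apply/eqP; lia.
by have := chevalley_hx ch k i; rewrite cartan_far ?scale0r //; apply/eqP; lia.
Qed.

Lemma cartan_root_pre i d : ope (h i) (e (i + 1) d) (- e (i + 1) d) 0.
Proof.
have h1 : ope (h i) (x (i + 1)) (- x (i + 1)) 0.
  by have := chevalley_hx ch i (i + 1); rewrite cartan_succ scaleN1r.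
case: d => [|d] //.
have h2 : ope (h i) (e (i + 1 + 1) d) 0 0 by apply: cartan_root_far; lia.
have := ope_bracketr h1 h2 (ope_oppl (simple_root_pre (i + 1) d)).
by rewrite nprod0r add0r oppr0.
Qed.

Lemma opposite_simple k i :
  ope (y k) (x i) (- ((k == i)%:R *: h i)) ((k == i)%:R * l).
Proof. by rewrite eq_sym; exact: ope_skew (chevalley_xy ch i k). Qed.

Lemma opposite_simple_neq k i : k != i -> ope (y k) (x i) 0 0.
Proof. by move=> /negPf ki; have := opposite_simple k i; rewrite ki scale0r oppr0 mul0r. Qed.

Lemma opposite_root_far k i d : (k < i) || (i + d%:Z < k) -> ope (y k) (e i d) 0 0.
Proof.
elim: d i => [|d IH] i ki; first by apply: opposite_simple_neq; apply/eqP; lia.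
apply: ope_commute0; first by apply: opposite_simple_neq; apply/eqP; lia.
by apply: IH; lia.
Qed.

(** Bracketing y_i with x_i gives - h_i, which acts by + 1 on the remaining string: h_i only meets
    its letter x_(i+1), and a_(i,i+1) = -1. *)
Lemma opposite_root_first i d : ope (y i) (e i d.+1) (e (i + 1) d) 0.
Proof.
have h1 := opposite_simple i i; rewrite eqxx scale1r mul1r in h1.
have h2 : ope (y i) (e (i + 1) d) 0 0 by apply: opposite_root_far; lia.
have := ope_bracketr h1 h2 (ope_oppl (cartan_root_pre i d)).
by rewrite nprod0r add0r opprK oppr0.
Qed.

Lemma opposite_root_last i d : ope (y (i + d%:Z + 1)) (e i d.+1) (- e i d) 0.
Proof.
elim: d i => [|d IH] i.
  have h1 : ope (y (i + 1)) (x i) 0 0 by apply: opposite_simple_neq; apply/eqP; lia.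
  have := ope_commute h1 (opposite_simple (i + 1) (i + 1)).
  rewrite eqxx scale1r nprodNr (ope_skew (chevalley_hx ch (i + 1) i) 0%N).
  by rewrite cartan_pred scaleN1r opprK addr0.
have h1 : ope (y (i + d.+1%:Z + 1)) (x i) 0 0.
  by apply: opposite_simple_neq; apply/eqP; lia.
have := ope_commute h1; rewrite (_ : i + d.+1%:Z + 1 = i + 1 + d%:Z + 1); last by lia.
by move/(_ _ _ _ (IH (i + 1))); rewrite nprodNr.
Qed.

(** The critical case is k = i + 1: y_k removes the letter x_k and leaves the bracket of x_i with
    the string starting at i + 2, which is zero. *)
Lemma opposite_root_mid k i d : i < k < i + d%:Z -> ope (y k) (e i d) 0 0.
Proof.
elim: d i => [|d IH] i ki; first by lia.
have h1 : ope (y k) (x i) 0 0 by apply: opposite_simple_neq; apply/eqP; lia.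
have [ki1|ki1] := eqVneq k (i + 1); last first.
  by apply: ope_commute0 => //; apply: IH; lia.
case: d IH ki => [|d] IH ki; first by lia.
rewrite ki1 in h1 *; have := ope_commute h1 (opposite_root_first (i + 1) d).
by rewrite (@simple_root_far i (i + 1 + 1) d _ 0%N) //; lia.
Qed.

Lemma opposite_root k i d : ope (y k) (e i d.+1)
  ((k == i)%:R *: e (i + 1) d - (k == i + d%:Z + 1)%:R *: e i d) 0.
Proof.
case: (k =P i) => [->|ki].
  rewrite (_ : _ == _ = false); last by apply/eqP; lia.
  by rewrite scale1r scale0r subr0; exact: opposite_root_first.
case: eqP => [->|kj]; rewrite scale0r sub0r.
  by rewrite scale1r; exact: opposite_root_last.
rewrite scale0r oppr0.
have [|] := boolP (i < k < i + d.+1%:Z); first exact: opposite_root_mid.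
by move=> h1; apply: opposite_root_far; lia.
Qed.

End RootVectors.
End ChevalleyFamilies.

(** * The linear map from matrices to the vertex algebra *)

Section MatrixRepresentation.
Variables (K : numFieldType) (V : lmodType K) (Y : vertexAlgebra V).
Local Notation gl := (fsf (int * int)%type (K^o)).
Local Notation matE := (matE K).

(* The diagonal units are sent to a sequence with successive differences h; only its
   differences matter, since psi is used on sl only. *)
Definition diagv (h : int -> V) (i : int) : V :=
  match i with
  | Posz n => - \sum_(k < n) h k%:Z
  | Negz n => \sum_(k < n.+1) h (Negz k)
  end.

(** The lower half is the upper one transported by the involution E_(i,j) |-> - E_(j,i), x_i |-> -
    y_i; the outer sign makes E_(i+1,i) go to y_i. *)
Definition unitv (x y h : int -> V) (p : int * int) : V :=
  if p.1 < p.2 then rootv Y x p.1 (absz (p.2 - p.1 - 1)%R)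
  else if p.2 < p.1 then - rootv Y (fun i => - y i) p.2 (absz (p.1 - p.2 - 1)%R)
  else diagv h p.1.

Definition psi (x y h : int -> V) (a : gl) : V :=
  \sum_(p \in [set: int * int]%classic) (a p : K) *: unitv x y h p.

Lemma diagv_succ h i : diagv h i - diagv h (i + 1) = h i.
Proof.
case: i => [n|[|n]].
- by rewrite -PoszD addn1 /= big_ord_recr /= opprK addKr.
- by rewrite /= big_ord1 big_ord0 oppr0 subr0.
- have -> : Negz n.+1 + 1 = Negz n by lia.
  by rewrite /= big_ord_recr /= addrAC subrr add0r.
Qed.

Lemma diagv_opp h i : diagv (fun j => - h j) i = - diagv h i.
Proof. by case: i => n /=; rewrite sumrN. Qed.

Lemma psi_linear x y h : linear (psi x y h).
Proof.
apply: (ext_linear (F := fun p (c : K^o) => (c : K) *: unitv x y h p)) => p a u v.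
by rewrite scalerDl scalerA.
Qed.

Lemma psi_matE x y h i j : psi x y h (matE i j) = unitv x y h (i, j).
Proof.
rewrite /psi (fsbig_mono (F := fun p (c : K^o) => (c : K) *: unitv x y h p)).
  by rewrite scale1r.
by move=> p; rewrite scale0r.
Qed.

Lemma psi_upper x y h i j (d : nat) : j = i + d%:Z + 1 ->
  psi x y h (matE i j) = rootv Y x i d.
Proof.
move=> ->; rewrite psi_matE /unitv /= ifT; last by lia.
by congr (rootv _ _ _ _); lia.
Qed.

Lemma psi_lower x y h i j (d : nat) : i = j + d%:Z + 1 ->
  psi x y h (matE i j) = - rootv Y (fun k => - y k) j d.
Proof.
move=> ->; rewrite psi_matE /unitv /= ifF; last by lia.
rewrite ifT; last by lia.
by congr (- rootv _ _ _ _); lia.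
Qed.

Lemma psi_cartan x y h i : psi x y h (matE i i - matE (i + 1) (i + 1)) = h i.
Proof.
by rewrite (linear_sub (psi_linear x y h)) !psi_matE /unitv /= !ltxx diagv_succ.
Qed.

Lemma psi_transpose x y h i j :
  psi (fun k => - y k) (fun k => - x k) (fun k => - h k) (matE i j) =
  - psi x y h (matE j i).
Proof.
rewrite !psi_matE /unitv /=; case: ltgtP => ij; rewrite ?opprK //.
- by congr (- rootv _ _ _ _); apply/funext => k; rewrite opprK.
- by rewrite diagv_opp ij.
Qed.

Variables (l : K) (x y h : int -> V).
Hypothesis ch : chevalley Y l x y h.

(** Stated for every Chevalley family, so that the opposite one yields the products with y_k. Upper
    units are [simple_root]; lower ones are [opposite_root] for the opposite family, except the
    simple lower units, where h and the level enter. *)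
Lemma psi_simple_ope x' y' h' : chevalley Y l x' y' h' -> forall k i j, i != j ->
  ope Y (x' k) (psi x' y' h' (matE i j)) (psi x' y' h' (gl_br (matE k (k + 1)) (matE i j)))
    (l * gl_form (matE k (k + 1)) (matE i j)).
Proof.
move=> ch' k i j ij; have lp := psi_linear x' y' h'.
rewrite gl_br_matE gl_form_matE (linear_sub lp) !(linear_scale lp).
have [ltij|] := ltP i j.
  have [d jE] : exists d : nat, j = i + d%:Z + 1 by exists (absz (j - i - 1)%R); lia.
  rewrite (psi_upper _ _ _ jE) [k == j]eq_sym jE.
  have -> : (i + d%:Z + 1 == k) && (k + 1 == i) = false by apply/negP => /andP[]; lia.
  rewrite mulr0; have := simple_root ch' k i d; rewrite [k == _]eq_sym.
  congr (ope _ _ _ (_ - _) _).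
    by case: eqP => [ki|_]; rewrite ?scale0r // (@psi_upper _ _ _ _ _ d.+1) //; lia.
  by case: eqP => [ki|_]; rewrite ?scale0r // (@psi_upper _ _ _ _ _ d.+1) //; lia.
rewrite le_eqVlt eq_sym (negPf ij) /= => ltji.
have [d iE] : exists d : nat, i = j + d%:Z + 1 by exists (absz (i - j - 1)%R); lia.
rewrite (psi_lower _ _ _ iE).
case: d iE => [|d] iE.
  have -> : (k + 1 == i) = (k == j) by apply/eqP/eqP; lia.
  rewrite [j == k]eq_sym andbb /= opprK mulrC -scalerBr.
  have := chevalley_xy ch' k j; congr (ope _ _ _ _ _).
  case: eqP => [->|_]; rewrite ?scale0r // !scale1r -(linear_sub lp).
  by rewrite iE addr0 psi_cartan.
have -> : (k == j) && (k + 1 == i) = false by apply/negP => /andP[]; lia.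
rewrite mulr0; have := ope_oppl (ope_oppr (opposite_root (chevalley_opp ch') k j d)).
rewrite !opprK; congr (ope _ _ _ _ _).
rewrite [RHS]addrC [j == k]eq_sym; congr (_ + _).
  case: eqP => [kj|_]; rewrite ?scale0r ?oppr0 // (@psi_lower _ _ _ _ _ d) ?scalerN ?opprK ?kj //.
  by lia.
have -> : (k == j + d%:Z + 1) = (k + 1 == i) by apply/eqP/eqP; lia.
case: eqP => [ki|_]; rewrite ?scale0r ?oppr0 // (@psi_lower _ _ _ _ _ d) ?scalerN //.
by lia.
Qed.

Lemma psi_x_ope k a : a \in span (@gl_commutators K) ->
  ope Y (x k) (psi x y h a) (psi x y h (gl_br (matE k (k + 1)) a))
    (l * gl_form (matE k (k + 1)) a).
Proof.
have lp := psi_linear x y h; move: a; apply: sl_span_ind => [c a b ha hb|i j ij|i].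
- rewrite (gl_br_linr _ c) !lp (gl_form_linr _ c) mulrDr mulrCA.
  exact: ope_linr.
- exact: psi_simple_ope.
rewrite psi_cartan gl_br_raise_cartan (linear_sub (gl_form_linr _)) (linear_scale lp) scaleNr.
rewrite (@psi_upper _ _ _ _ _ 0) ?addr0 // !gl_form_diag ?succ_neq // subrr mulr0.
exact: ope_skew (chevalley_hx ch i k).
Qed.

Lemma psi_y_ope k a : a \in span (@gl_commutators K) ->
  ope Y (y k) (psi x y h a) (psi x y h (gl_br (matE (k + 1) k) a))
    (l * gl_form (matE (k + 1) k) a).
Proof.
have lp := psi_linear x y h; move: a; apply: sl_span_ind => [c a b ha hb|i j ij|i].
- rewrite (gl_br_linr _ c) !lp (gl_form_linr _ c) mulrDr mulrCA.
  exact: ope_linr.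
- have ji : j != i by rewrite eq_sym.
  have lp' := psi_linear (fun i => - y i) (fun i => - x i) (fun i => - h i).
  have := psi_simple_ope (chevalley_opp ch) k ji.
  rewrite !gl_br_matE (linear_sub lp') (linear_sub lp) !(linear_scale lp').
  rewrite !(linear_scale lp) !psi_transpose => /ope_oppl/ope_oppr.
  rewrite !opprK !scalerN opprK addrC !gl_form_matE.
  by rewrite [j == k + 1]eq_sym [i == k]eq_sym andbC.
rewrite psi_cartan gl_br_lower_cartan (linear_sub (gl_form_linr _)) (linear_scale lp).
rewrite (@psi_lower _ _ _ _ _ 0) ?addr0 // opprK !gl_form_diag ?neq_succ // subrr mulr0.
by have := ope_skew (chevalley_hy ch i k); rewrite opprK.
Qed.

(** Induction on [a] with [b] ranging over sl. For a = [u, v], [ope_bracketl] combines the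
    hypotheses; the Jacobi identity identifies the simple pole and invariance of the form the double
    one. Membership in sl is carried along since the hypothesis for u is applied to v. *)
Lemma psi_ope a b : a \in span (@gl_commutators K) -> b \in span (@gl_commutators K) ->
  ope Y (psi x y h a) (psi x y h b) (psi x y h (gl_br a b)) (l * gl_form a b).
Proof.
have lp := psi_linear x y h; have brS u v : gl_br u v \in span (@gl_commutators K).
  by apply: span_incl; exists u, v.
move=> aS; have {aS}: a \in span (@gl_commutators K) /\ forall b,
    b \in span (@gl_commutators K) ->
    ope Y (psi x y h a) (psi x y h b) (psi x y h (gl_br a b)) (l * gl_form a b); last first.
  by case=> _; apply.
move: a aS {b}; apply: sl_gen_ind => [c u v [uS hu] [vS hv]|k|k|u v [uS hu] [vS hv]].
- split=> [|b bS]; first by rewrite rpredD ?rpredZ.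
  rewrite (gl_br_linl _ c) !lp (gl_form_linl _ c) mulrDr mulrCA.
  exact: ope_linl (hu b bS) (hv b bS).
- split=> [|b bS]; first exact/X_subproof/succ_neq.
  by rewrite (@psi_upper _ _ _ _ _ 0) ?addr0 //; exact: psi_x_ope.
- split=> [|b bS]; first exact/X_subproof/neq_succ.
  by rewrite (@psi_lower _ _ _ _ _ 0) ?addr0 // opprK; exact: psi_y_ope.
split=> // b bS; rewrite -[psi x y h (gl_br u v)](hu v vS 0%N).
have := ope_bracketl (hu b bS) (hv b bS) (hv (gl_br u b) (brS _ _)).
by rewrite (hu _ (brS v b) 0%N) -(linear_sub lp) -gl_jacobi gl_form_br mulrN.
Qed.

End MatrixRepresentation.

(** * Affine module structure *)

Section AffineModule.
Variables (K : numFieldType) (l : K) (Y : vertexAlgebra (V_aff l)).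
Hypothesis hY : is_V_aff Y.
Variables (W : lmodType K) (Z : vertexAlgebra W) (x y h : int -> W).
Hypothesis ch : chevalley Z l x y h.

Lemma aff_br_bilinear : (forall g : fsf int (sl K), linear (fun f => aff_br (f, 0) (g, 0))) /\
  (forall f : fsf int (sl K), linear (fun g => aff_br (f, 0) (g, 0))).
Proof.
pose B1 (m n : int) (a b : sl K) : fsf int (sl K) := mono (m + n) (sl_br a b).
pose B2 (m n : int) (a b : sl K) : K^o :=
  m%:~R * (m + n == 0)%:R * gl_form (subval a) (subval b).
have [l1 r1] : (forall g : fsf int (sl K), linear (fun f : fsf int (sl K) =>
     \sum_(i \in [set: int]%classic) \sum_(j \in [set: int]%classic) B1 i j (f i) (g j))) /\
  (forall f : fsf int (sl K), linear (fun g : fsf int (sl K) =>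
     \sum_(i \in [set: int]%classic) \sum_(j \in [set: int]%classic) B1 i j (f i) (g j))).
  apply: biext_linear => m n b a u v; rewrite /B1.
    by rewrite (sl_br_linl b a) mono_linear.
  by rewrite (sl_br_linr b a) mono_linear.
have [l2 r2] : (forall g : fsf int (sl K), linear (fun f : fsf int (sl K) =>
     \sum_(i \in [set: int]%classic) \sum_(j \in [set: int]%classic) B2 i j (f i) (g j))) /\
  (forall f : fsf int (sl K), linear (fun g : fsf int (sl K) =>
     \sum_(i \in [set: int]%classic) \sum_(j \in [set: int]%classic) B2 i j (f i) (g j))).
  apply: biext_linear => m n b a u v; rewrite /B2.
    by rewrite (gl_form_linl _ a) mulrDr mulrCA.
  by rewrite (gl_form_linr _ a) mulrDr mulrCA.
split=> [g|f] a u v; first by congr (_, _); [exact: l1|exact: l2].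
by congr (_, _); [exact: r1|exact: r2].
Qed.

Let pz (a : sl K) := psi Z x y h (subval a).

Definition loop_act (f : fsf int (sl K)) (w : W) : W :=
  \sum_(m \in [set: int]%classic) nprod Z (pz (f m)) m w.

Lemma pz_linear : linear pz.
Proof. by move=> a u v; rewrite /pz /= psi_linear. Qed.

Lemma loop_act_linear w : linear (fun f => loop_act f w).
Proof.
apply: (ext_linear (F := fun m a => nprod Z (pz a) m w)) => m a u v.
by rewrite pz_linear (nprod_linl Z).
Qed.

Lemma loop_act_mono m a w : loop_act (mono m a) w = nprod Z (pz a) m w.
Proof.
rewrite /loop_act (fsbig_mono (F := fun m a => nprod Z (pz a) m w)) // => j.
by rewrite (linear_at0 pz_linear) nprod0.
Qed.

Lemma loop_act_linear_r f : linear (loop_act f).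
Proof.
move: f; apply: fsf_ind => [|c f g hf hg|m a] k u v.
- by rewrite !(linear_at0 (loop_act_linear _)) scaler0 addr0.
- rewrite !(loop_act_linear _ c) hf hg !scalerDr !scalerA [c * k]mulrC -!addrA.
  by congr (_ + _); rewrite addrCA.
- by rewrite !loop_act_mono (nprod_linr Z).
Qed.

Definition aff_act (X : aff_sl K) (w : W) : W := loop_act X.1 w + (l * X.2) *: w.

Lemma aff_act_linl w : linear (aff_act^~ w).
Proof.
move=> a [f c] [g d]; rewrite /aff_act /= loop_act_linear mulrDr scalerDl scalerDr scalerA.
rewrite mulrCA -!addrA; congr (_ + _); rewrite addrCA; congr (_ + _).
Qed.

Lemma aff_act_linr X : linear (aff_act X).
Proof.
move=> a u v; rewrite /aff_act loop_act_linear_r !scalerDr !scalerA [a * _]mulrC.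
by rewrite -!addrA; congr (_ + _); rewrite addrCA.
Qed.

(** Bilinearity reduces this to monomials, where it is the commutator formula for the operator
    product in [psi_ope]. *)
Lemma aff_act_loop f g w : aff_act (aff_br (f, 0) (g, 0)) w =
  loop_act f (loop_act g w) - loop_act g (loop_act f w).
Proof.
move: f; apply: fsf_ind => [|c f f' hf hf'|m a].
- rewrite (linear_at0 (aff_br_bilinear.1 g)) (linear_at0 (aff_act_linl w)).
  by rewrite !(linear_at0 (loop_act_linear _)) (linear_at0 (loop_act_linear_r _)) subr0.
- rewrite (aff_br_bilinear.1 g c) (aff_act_linl w c) hf hf' !(loop_act_linear _ c).
  rewrite (loop_act_linear_r _ c) scalerBr opprD !addrA; congr (_ - _).
  by rewrite addrAC.
move: g; apply: fsf_ind => [|c g g' hg hg'|n b].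
- rewrite (linear_at0 (aff_br_bilinear.2 _)) (linear_at0 (aff_act_linl w)).
  by rewrite !(linear_at0 (loop_act_linear _)) (linear_at0 (loop_act_linear_r _)) subr0.
- rewrite (aff_br_bilinear.2 _ c) (aff_act_linl w c) hg hg' !(loop_act_linear _ c).
  rewrite (loop_act_linear_r _ c) scalerBr opprD !addrA; congr (_ - _).
  by rewrite addrAC.
rewrite !loop_act_mono (ope_commutator _ _ _ (psi_ope ch (subvalP a) (subvalP b))).
by rewrite -[(mono m a, 0)]/(aff_mono a m) aff_brE /aff_act /= loop_act_mono mulrCA.
Qed.

Lemma aff_act_br X1 X2 w :
  aff_act (aff_br X1 X2) w = aff_act X1 (aff_act X2 w) - aff_act X2 (aff_act X1 w).
Proof.
case: X1 X2 => [f c] [g d]; rewrite -[aff_br _ _]/(aff_br (f, 0) (g, 0)) aff_act_loop.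
rewrite /aff_act /= !(linear_add (loop_act_linear_r _)) !(linear_scale (loop_act_linear_r _)).
rewrite !scalerDr !scalerA [l * c * _]mulrC !opprD !addrA.
by rewrite [RHS](ACl ((1*5)*(2*7)*(3*6)*(4*8))) /= !subrr !addr0.
Qed.

Lemma aff_act_nonneg p : aff_nonneg p -> aff_act p (vac Z) = (l * p.2) *: vac Z.
Proof.
move=> hp; rewrite /aff_act /loop_act fsbig1 ?add0r // => -[m|m] _.
  exact: nprod_vac_r.
by rewrite hp // (linear_at0 pz_linear) nprod0.
Qed.

Lemma V_aff_hom : exists2 f : V_aff l -> W, va_hom Y Z f & forall a, f (V_aff_gen l a) = pz a.
Proof.
have [f [lf f1 fM]] := induced_hom aff_act_linl aff_act_linr aff_act_br aff_act_nonneg.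
have fgn a : f (V_aff_gen l a) = pz a.
  rewrite /V_aff_gen /V_aff_word fM f1 /aff_act /= mulr0 scale0r addr0 loop_act_mono.
  exact: nprod_creation.
exists f => //; apply: (va_hom_generated (V_aff_generated hY) lf); first by rewrite hY.1.
move=> _ n v [s [i ->]]; rewrite fgn; move: v; apply: iword_ind => [a u v hu hv|w].
  by rewrite !(nprod_linr _ _ n a) !lf (nprod_linr _ _ n a) hu hv.
rewrite -[iword _ _ _ _]/(V_aff_word l w) hY.2 /V_aff_word fM /aff_act /= mulr0 scale0r addr0.
by rewrite loop_act_mono.
Qed.

End AffineModule.

(** * Brackets and form on the Chevalley generators of sl *)

Section SimpleRootVectors.
Variable K : numFieldType.
Local Notation matE := (matE K).
Local Notation gl := (fsf (int * int)%type (K^o)).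

Lemma subval_slX s i : subval (slX K s i) =
  matE (if s then i else i + 1) (if s then i + 1 else i).
Proof. by case: s. Qed.

Lemma subval_slH i : subval (slH K i) = matE i i - matE (i + 1) (i + 1).
Proof. by []. Qed.

Lemma sl_br_HH i j : sl_br (slH K i) (slH K j) = 0.
Proof.
have e p q : gl_br (matE p p) (matE q q) = 0.
  by rewrite gl_br_matE [q == p]eq_sym; case: eqP => [->|_]; rewrite ?scale0r subrr.
apply: val_inj; rewrite [LHS]/= (linear_sub (gl_br_linl _)) !(linear_sub (gl_br_linr _)).
by rewrite !e !subrr.
Qed.

Lemma sl_br_XH s i j : sl_br (slX K s i) (slH K j) =
  (- (-1) ^+ (~~ s) * (cartan j i)%:~R) *: slX K s i.
Proof.
apply: val_inj; case: s; rewrite /= ?gl_br_raise_cartan ?gl_br_lower_cartan.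
  by rewrite expr0 mulN1r.
by rewrite expr1 opprK mul1r.
Qed.

Lemma sl_br_HX s i j : sl_br (slH K i) (slX K s j) =
  ((-1) ^+ (~~ s) * (cartan i j)%:~R) *: slX K s j.
Proof.
apply: val_inj; rewrite /= gl_brC -[gl_br _ _]/(subval (sl_br (slX K s j) (slH K i))).
by rewrite sl_br_XH /= mulNr scaleNr opprK.
Qed.

Lemma sl_br_XY i j : sl_br (slX K true i) (slX K false j) = (i == j)%:R *: slH K i.
Proof.
apply: val_inj; rewrite /= gl_br_matE [j == i]eq_sym.
have -> : (i + 1 == j + 1) = (i == j) by apply/eqP/eqP; lia.
by case: eqP => [->|_]; rewrite ?scale1r ?scale0r ?subr0.
Qed.

Lemma sl_br_XX s i j : cartan i j != -1 -> sl_br (slX K s i) (slX K s j) = 0.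
Proof.
rewrite cartanE => ij; apply: val_inj; rewrite /= !subval_slX gl_br_matE.
case: s; (case: eqP => [ij1|_]; first by lia);
  (case: eqP => [ij2|_]; first by lia); by rewrite !scale0r subrr.
Qed.

Lemma sl_br_serre s i j : i != j -> sl_br (slX K s i) (sl_br (slX K s i) (slX K s j)) = 0.
Proof.
move=> /eqP ij; apply: val_inj; rewrite /= !subval_slX gl_br_matE.
rewrite (linear_sub (gl_br_linr _)) !(linear_scale (gl_br_linr _)) !gl_br_matE.
have n1 : (i + 1 == i) = false by exact/negbTE/neq_succ.
have n2 : (i == i + 1) = false by exact/negbTE/succ_neq.
have n3 : i + 1 = j -> (j + 1 == i) = false by move=> e; apply/eqP; lia.
have n4 : i = j + 1 -> (j == i + 1) = false by move=> e; apply/eqP; lia.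
have z := (@scale0r K gl, @scaler0 K gl, @subr0 gl, @sub0r gl, @oppr0 gl).
by case: s; rewrite ?n1 ?n2; case: eqP => [e|_]; rewrite ?(n3 e) ?(n4 e) !z.
Qed.

Lemma gl_form_XX s i j : gl_form (subval (slX K s i)) (subval (slX K s j)) = 0.
Proof.
rewrite !subval_slX gl_form_matE (_ : _ && _ = false) //.
by case: s; apply/negP => /andP[]; lia.
Qed.

Lemma gl_form_XY i j :
  gl_form (subval (slX K true i)) (subval (slX K false j)) = (i == j)%:R.
Proof.
rewrite !subval_slX gl_form_matE; congr (_%:R : K).
by have [->|ij] := eqVneq i j; rewrite ?eqxx //; case: eqP => // /eqP; rewrite (negPf ij).
Qed.

Lemma gl_form_XH s i j : gl_form (subval (slX K s i)) (subval (slH K j)) = 0.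
Proof.
rewrite subval_slX subval_slH (linear_sub (gl_form_linr _)).
by rewrite !gl_form_diag ?subrr //; case: s; rewrite ?succ_neq ?neq_succ.
Qed.

Lemma gl_form_HH i j :
  gl_form (subval (slH K i)) (subval (slH K j)) = (cartan i j)%:~R.
Proof.
rewrite !subval_slH (linear_sub (gl_form_linl _)) !(linear_sub (gl_form_linr _)).
rewrite !gl_form_matE !andbb cartanE !intrB !intrD [i == j + 1]eq_sym opprB.
by rewrite addrA [LHS](ACl (1*3*2*4)).
Qed.

End SimpleRootVectors.

(** * The two homomorphisms *)

Section Presentation.
Variables (K : numFieldType) (l : K) (C : conformalLie K) (iota : gen -> C).
Hypothesis hC : is_conformal_of locN iota.
Variable YC : vertexAlgebra (V_C C).
Hypothesis hYC : is_V_C YC.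
Variable Y : vertexAlgebra (V_aff l).
Hypothesis hY : is_V_aff Y.
Local Notation F2 := (FI2 l iota YC).
Local Notation fh := (FI2_h l iota YC).
Local Notation fx := (FI2_x l iota YC).
Local Notation gn := (V_aff_gen l).

Definition FI2_proj (v : V_C C) : FI2_car l iota YC :=
  cls (ideal_gen (F_va l iota YC) (I2_relator (YC:=YC)))
    (cls (ideal_gen YC (I1_relator l iota YC)) v).

Definition FI2_gen (g : gen) : FI2_car l iota YC :=
  match g with hgen i => fh i | xgen s i => fx s i end.

Lemma FI2_proj_hom : va_hom YC F2 FI2_proj.
Proof. exact: va_hom_comp (va_hom_cls _ _) (va_hom_cls _ _). Qed.

Lemma FI2_proj_gen g : FI2_proj (V_C_gen (iota g)) = FI2_gen g.
Proof. by case: g. Qed.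

Lemma FI2_generated : va_generated F2 (range FI2_gen).
Proof.
have g1 := va_generated_quotient (R := I1_relator l iota YC) (V_C_generated hYC hC).
have g2 := va_generated_quotient (R := I2_relator (YC := YC)) g1.
move=> P P1 PD PM PG; apply: (g2 P) => //.
by move=> _ [_ [_ [g _ <-] <-] <-]; apply: PG; exists g => //; rewrite -FI2_proj_gen.
Qed.

Lemma FI2_local a b (n : nat) : (locN a b <= n)%N -> nprod F2 (FI2_gen a) n (FI2_gen b) = 0.
Proof.
have [lp p1 pM] := FI2_proj_hom.
move=> abn; rewrite -!FI2_proj_gen -pM (V_C_local hYC hC abn).
exact: linear_at0.
Qed.

Lemma FI2_I1 v : I1_relator l iota YC v -> FI2_proj v = 0.
Proof. by move=> /(ideal_gen0 YC) h; rewrite /FI2_proj h linear0. Qed.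

(** Products beyond the order [locN] vanish by locality, and the lower ones are read off from the
    relators. The entry a_(i,i) = 2 is outside the Serre relators; there x_i has order 0 with
    itself. *)
Lemma FI2_chevalley : chevalley F2 l (fx true) (fx false) fh.
Proof.
have [lp p1 pM] := FI2_proj_hom.
have [lq q1 qM] := va_hom_cls (F_va l iota YC) (I2_relator (YC:=YC)).
set q := cls _ in lq q1 qM *.
have qI2 v : I2_relator (YC := YC) v -> q v = 0 by exact: ideal_gen0.
have hE i : FI2_proj (V_C_gen (iota (hgen i))) = fh i by [].
have xE s i : FI2_proj (V_C_gen (iota (xgen s i))) = fx s i by [].
have hx s i j : ope F2 (fh i) (fx s j) (((-1) ^+ (~~ s) * (cartan i j)%:~R) *: fx s j) 0.
  case=> [|n]; last first.
    by rewrite (@FI2_local (hgen i) (xgen s j)) //; case: n => // *; rewrite scale0r.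
  have := FI2_I1 (I1_hx l iota YC i s j).
  rewrite (linear_sub lp) pM (linear_scale lp) hE xE => /eqP.
  by rewrite subr_eq0 => /eqP.
have xx s i j : ope F2 (fx s i) (fx s j) (nprod F2 (fx s i) 0 (fx s j)) 0.
  case=> [|n] //; rewrite (@FI2_local (xgen s i) (xgen s j)) /= ?eqxx.
    by case: n => // *; rewrite scale0r.
  by case: (i != j).
have serre s i j : cartan i j <= 0 ->
    iter `|1 - cartan i j|%N (nprod F2 (fx s i) 0) (fx s j) = 0.
  move=> ij; have := qI2 _ (I2_serre l iota YC s ij).
  have q_iter k v : q (iter k (nprod (F_va l iota YC) (F_x l iota YC s i) 0) v) =
      iter k (nprod F2 (fx s i) 0) (q v) by elim: k => //= k IH; rewrite qM IH.
  by rewrite q_iter.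
have xx0 s i j : cartan i j != -1 -> nprod F2 (fx s i) 0 (fx s j) = 0.
  move=> ij1; have [->|ij] := eqVneq i j.
    by apply: (@FI2_local (xgen s j) (xgen s j) 0); rewrite /= !eqxx.
  have ij0 : cartan i j = 0 by move: ij1; rewrite /cartan (negPf ij); case: ifP.
  by have := serre s i j; rewrite ij0 subr0; apply.
have xxx s i j : cartan i j = -1 -> nprod F2 (fx s i) 0 (nprod F2 (fx s i) 0 (fx s j)) = 0.
  by move=> ij; have := serre s i j; rewrite ij; apply.
split=> [i j|i j|i j|i j|i j|i j|i j|i j|i j].
- by have := hx true i j; rewrite expr0 mul1r.
- by have := hx false i j; rewrite expr1 mulN1r scaleNr.
- case=> [|[|n]].
  + have := qI2 _ (I2_xx0 l iota YC i j).
    by rewrite (linear_sub lq) qM (linear_scale lq) => /eqP; rewrite subr_eq0 => /eqP.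
  + have := qI2 _ (I2_xx1 l iota YC i j).
    by rewrite (linear_sub lq) qM (linear_scale lq) q1 => /eqP; rewrite subr_eq0 => /eqP.
  + by rewrite (@FI2_local (xgen true i) (xgen false j)) //=; case: (i == j).
- exact: xx.
- exact: xx.
- exact: xx0.
- exact: xx0.
- exact: xxx.
- exact: xxx.
Qed.

Definition V_aff_of_gen (g : gen) : V_aff l :=
  match g with hgen i => gn (slH K i) | xgen s i => gn (slX K s i) end.

(** Order 2 allows a nonzero form, order 1 requires the form to vanish, and order 0 the bracket as
    well. *)
Lemma V_aff_local a b (n : nat) : (locN a b <= n)%N ->
  nprod Y (V_aff_of_gen a) n (V_aff_of_gen b) = 0.
Proof.
have gn0 := linear_at0 (V_aff_gen_linear l).
case: a b => [i|s i] [j|t j] /=.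
- by case: n => [|[|n]] // _; rewrite (V_aff_ope hY).
- case: n => [|[|n]] // _; rewrite (V_aff_ope hY) //.
  by rewrite gl_formC gl_form_XH mulr0 scale0r.
- by case: n => [|[|n]] // _; rewrite (V_aff_ope hY) // gl_form_XH mulr0 scale0r.
case: eqP => [->|/eqP st].
  rewrite (V_aff_ope hY); case: n => [|[|n]] // ij; last by rewrite gl_form_XX mulr0 scale0r.
  by rewrite sl_br_XX ?gn0 //; move: ij; case: eqP => // ->; rewrite /cartan eqxx.
case: s t st => [] [] // _; last rewrite [i == j]eq_sym; case: eqP => [->|/eqP ij].
- by case: n => [|[|n]] // _; rewrite (V_aff_ope hY).
- move=> _; rewrite (V_aff_ope hY) sl_br_XY gl_form_XY (negPf ij).
  by rewrite scale0r gn0 mulr0 scale0r; case: n => [|[|n]].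
- by case: n => [|[|n]] // _; rewrite (V_aff_ope hY).
move=> _; rewrite (ope_skew (V_aff_ope hY _ _)) sl_br_XY gl_form_XY (negPf ij).
by rewrite scale0r gn0 mulr0 scale0r oppr0; case: n => [|[|n]].
Qed.

Lemma FI2_to_V_aff : exists2 g : FI2_car l iota YC -> V_aff l,
  va_hom F2 Y g & forall a, g (FI2_gen a) = V_aff_of_gen a.
Proof.
have lgn := V_aff_gen_linear l; have gn0 := linear_at0 lgn.
have [F homF Fgn] := V_C_universal hYC hC V_aff_local.
have [lF F1 FM] := homF.
have Fh i : F (V_C_gen (iota (hgen i))) = gn (slH K i) by rewrite Fgn.
have Fx s i : F (V_C_gen (iota (xgen s i))) = gn (slX K s i) by rewrite Fgn.
have [|G homG GE] := va_quotient_hom (R := I1_relator l iota YC) homF.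
  move=> _ [i j|i j|i s j].
  - by rewrite FM !Fh (V_aff_ope hY _ _ 0%N) sl_br_HH.
  - rewrite (linear_sub lF) FM !Fh (V_aff_ope hY _ _ 1%N) (linear_scale lF) F1.
    by rewrite gl_form_HH mulrC subrr.
  - rewrite (linear_sub lF) FM !Fh !Fx (V_aff_ope hY _ _ 0%N) (linear_scale lF) Fx.
    by rewrite sl_br_HX (linear_scale lgn) subrr.
have [lG G1 GM] := homG.
have Gh i : G (F_h l iota YC i) = gn (slH K i) by rewrite GE.
have Gx s i : G (F_x l iota YC s i) = gn (slX K s i) by rewrite GE.
have [|H homH HE] := va_quotient_hom (R := I2_relator (YC := YC)) homG.
  move=> _ [i j|i j|s i j ij].
  - rewrite (linear_sub lG) GM !Gx (V_aff_ope hY _ _ 0%N) (linear_scale lG) Gh.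
    by rewrite sl_br_XY (linear_scale lgn) subrr.
  - rewrite (linear_sub lG) GM !Gx (V_aff_ope hY _ _ 1%N) (linear_scale lG) G1.
    by rewrite gl_form_XY mulrC subrr.
  have G_iter k : G (iter k (nprod (F_va l iota YC) (F_x l iota YC s i) 0) (F_x l iota YC s j)) =
      gn (iter k (sl_br (slX K s i)) (slX K s j)).
    by elim: k => //= k IH; rewrite GM IH Gx (V_aff_ope hY _ _ 0%N).
  rewrite G_iter; move: ij; have [->|ij] := eqVneq i j; first by rewrite /cartan eqxx.
  have [ij1 _|ij1 _] := eqVneq (cartan i j) (-1).
    by rewrite ij1 /= sl_br_serre.
  have -> : cartan i j = 0 by move: ij1; rewrite /cartan (negPf ij); case: ifP.
  by rewrite subr0 /= sl_br_XX.
by exists H => // -[i|s i]; rewrite /= HE ?Gh ?Gx.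
Qed.

Lemma V_aff_to_FI2 : exists2 f : V_aff l -> FI2_car l iota YC,
  va_hom Y F2 f & forall a, f (V_aff_of_gen a) = FI2_gen a.
Proof.
have [f homf fE] := V_aff_hom hY FI2_chevalley.
exists f => // -[i|[] i]; rewrite /= fE.
- by rewrite subval_slH psi_cartan.
- by rewrite (@psi_upper _ _ _ _ _ _ _ _ 0) ?addr0.
- by rewrite (@psi_lower _ _ _ _ _ _ _ _ 0) ?addr0 //= opprK.
Qed.

End Presentation.

(** * Equivariance and the isomorphism *)

Lemma sigma_simple_root (K : numFieldType) (l : K) (N : nat) (sigma : int -> V_aff l -> V_aff l) :
  is_sigma N sigma -> forall n s i,
  sigma n (V_aff_gen l (slX K s i)) = V_aff_gen l (slX K s (i + n * N%:Z)).
Proof.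
move=> hs n s i; apply: hs => p q.
rewrite /sl_entry !subval_slX /fsf_val /= !xpair_eqE.
have e r : (r + n * N%:Z == i + n * N%:Z) = (r == i) by rewrite (inj_eq (addIr _)).
have e1 r : (r + n * N%:Z == i + n * N%:Z + 1) = (r == i + 1).
  by rewrite -addrAC (inj_eq (addIr _)).
by case: s; rewrite !e !e1.
Qed.
Theorem proposition3p9 (R : realType) (N : nat) (hN : (3 <= N)%N) (l : R[i])
  (Y : vertexAlgebra (V_aff l)) (hY : is_V_aff Y)
  (sigma : int -> V_aff l -> V_aff l)
  (hsigma : Z_action Y sigma) (hsigma' : is_sigma N sigma)
  (C : conformalLie R[i]) (iota : gen -> C) (hC : is_conformal_of locN iota)
  (YC : vertexAlgebra (V_C C)) (hYC : is_V_C YC)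
  (rho : int -> FI2_car l iota YC -> FI2_car l iota YC)
  (hrho : Z_action (FI2 l iota YC) rho) (hrho' : is_rho N rho) :
  exists f : V_aff l -> FI2_car l iota YC,
    [/\ Z_va_iso Y sigma (FI2 l iota YC) rho f,
        forall i, f (V_aff_gen l (slH _ i)) = FI2_h l iota YC i,
        forall s i, f (V_aff_gen l (slX _ s i)) = FI2_x l iota YC s i
      & forall g : V_aff l -> FI2_car l iota YC,
          va_hom Y (FI2 l iota YC) g ->
          (forall i, g (V_aff_gen l (slH _ i)) = FI2_h l iota YC i) ->
          (forall s i, g (V_aff_gen l (slX _ s i)) = FI2_x l iota YC s i) ->
          g =1 f].
Proof.
have [f homf fE] := V_aff_to_FI2 hC hYC hY.
have [g homg gE] := FI2_to_V_aff hC hYC hY.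
have genY := V_aff_generated hY.
have fX s i : f (V_aff_gen l (slX _ s i)) = FI2_x l iota YC s i by exact: (fE (xgen s i)).
have fK : cancel f g.
  apply: (va_hom_ext genY (va_hom_comp homf homg) (va_hom_id Y)).
  by move=> _ [s [i ->]]; rewrite /= fX (gE (xgen s i)).
have gK : cancel g f.
  apply: (va_hom_ext (FI2_generated hC hYC) (va_hom_comp homg homf) (va_hom_id _)).
  by move=> _ [a _ <-]; rewrite /= gE fE.
exists f; split=> //.
- split; first by split=> //; exists g.
  move=> n; have [hs _] := hsigma; have [hr _] := hrho.
  (* Both composites are homomorphisms, so it suffices that each sends a simple root vector of index
     i to the generator of index i + n N. *)
  apply: (va_hom_ext genY (va_hom_comp (hs n).1 homf) (va_hom_comp homf (hr n).1)).
  move=> _ [s [i ->]] /=; rewrite (sigma_simple_root hsigma') !fX.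
  by rewrite (hrho' n i).2.
- by move=> i; exact: (fE (hgen i)).
move=> g' homg' _ g'X; apply: (va_hom_ext genY homg' homf).
by move=> _ [s [i ->]]; rewrite fX g'X.
Qed.
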